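(* There exist a continuous unit vector field $X$ on $\mathbb{R}^2$, two foliations $\mathcal{F}$ and $\mathcal{G}$ of $\mathbb{R}^2$, each of them tangent to $X$, and a dense subset $\mathcal{E}$ of $\mathbb{R}^2$ such that at every point $x\in\mathcal{E}$ the leaves $F_x$ and $G_x$ of the foliations $\mathcal{F}$ and $\mathcal{G}$ through $x$ are topologically transverse.
   Context: A foliation of $\mathbb{R}^2$ here means a one-dimensional topological foliation whose leaves are $C^1$ curves. It is tangent to $X$ if, for every point $p\in\mathbb{R}^2$, the vector $X(p)$ spans the tangent line at $p$ of the leaf through $p$. Two curves $F_x$ and $G_x$ through $x$ are topologically transverse at $x$ if there are an open neighborhood $U$ of $x$ and a homeomorphism from $U$ onto $\mathbb{R}^2$ which sends $x$ to the origin, and sends the connected component of $F_x\cap U$ containing $x$ and the connected component of $G_x\cap U$ containing $x$ onto the two coordinate axes, respectively (so the two curves, although tangent at $x$, cross each other at $x$). *)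

(* Defs.v *)
From HB Require Import structures.
From mathcomp Require Import all_boot all_order all_algebra.
From mathcomp Require Import all_classical all_reals all_analysis.

Set Implicit Arguments.
Unset Strict Implicit.
Unset Printing Implicit Defensive.

Import Order.TTheory GRing.Theory Num.Theory.
Import numFieldNormedType.Exports.

Local Open Scope classical_set_scope.
Local Open Scope ring_scope.

Notation plane R := (R^o * R^o)%type.

(* The library norm on a product is the max norm, hence this definition. *)
Definition euclidean_norm (R : realType) (v : plane R) : R :=
  Num.sqrt (v.1 ^+ 2 + v.2 ^+ 2).

Definition continuous_unit_vector_field (R : realType)
    (X : plane R -> plane R) : Prop :=
  continuous X /\ forall p, euclidean_norm (X p) = 1.

Definition homeomorphism_between (S T : topologicalType)
    (A : set S) (B : set T) (h : S -> T) : Prop :=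
  set_bij A B h /\
  exists g : T -> S,
    [/\ {in A, cancel h g}, {within A, continuous h}
      & {within B, continuous g}].

(* A leaf is an injectively immersed copy of the line or of the circle; it is
   not required to be embedded. *)
Definition C1_parametrization (R : realType) (L : set (plane R))
    (c : R -> plane R) : Prop :=
  [/\ range c = L,
      forall t, derivable c t 1,
      continuous (derive1 c),
      forall t, derive1 c t != 0
    & injective c \/
      exists2 T : R, 0 < T &
        forall s t, c s = c t <-> exists k : int, s - t = T *~ k].

Definition C1_curve (R : realType) (L : set (plane R)) : Prop :=
  exists c, C1_parametrization L c.

(* In a chart domain U, the connected components of the traces L `&` U of the
   leaves L are exactly the preimages of the horizontal lines. *)
Definition foliated_chart (R : realType) (leaf : plane R -> set (plane R))
    (U : set (plane R)) (h : plane R -> plane R) : Prop :=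
  [/\ open U, homeomorphism_between U [set: plane R] h
    & forall q, U q ->
        connected_component (leaf q `&` U) q
        = [set z | U z /\ (h z).2 = (h q).2]].

(* The first two axioms say that the sets leaf p form a partition. *)
Record foliation (R : realType) := Foliation {
  leaf : plane R -> set (plane R);
  leaf_self : forall p, leaf p p;
  leaf_eq : forall p q, leaf p q -> leaf q = leaf p;
  leaf_C1 : forall p, C1_curve (leaf p);
  leaf_chart : forall p, exists U h, U p /\ foliated_chart leaf U h }.

Definition line_spanned (R : realType) (v : plane R) : set (plane R) :=
  [set s *: v | s in [set: R]].

(* For a leaf of a foliation the tangent line does not depend on the
   parametrization. *)
Definition is_tangent_line (R : realType) (L : set (plane R)) (p : plane R)
    (l : set (plane R)) : Prop :=
  exists (c : R -> plane R) (t : R),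
    [/\ C1_parametrization L c, c t = p & l = line_spanned (derive1 c t)].

Definition tangent_to (R : realType) (F : foliation R)
    (X : plane R -> plane R) : Prop :=
  forall p, is_tangent_line (leaf F p) p (line_spanned (X p)).

Definition topologically_transverse (R : realType) (A B : set (plane R))
    (x : plane R) : Prop :=
  exists (U : set (plane R)) (h : plane R -> plane R),
    [/\ open U /\ U x,
        homeomorphism_between U [set: plane R] h,
        h x = 0,
        h @` connected_component (A `&` U) x = [set z | z.2 = 0]
      & h @` connected_component (B `&` U) x = [set z | z.1 = 0]].

(* Main.v *)
Require Import Defs.
From mathcomp Require Import all_boot all_order all_algebra.
From mathcomp Require Import all_classical all_reals all_analysis.
From mathcomp Require Import measurable_realfun ring lra.
Import Order.TTheory GRing.Theory Num.Theory.
Import numFieldNormedType.Exports.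

Set Implicit Arguments.
Unset Strict Implicit.
Unset Printing Implicit Defensive.

Local Open Scope classical_set_scope.
Local Open Scope ring_scope.

(* Both foliations consist of graphs of solutions of an equation y' = v(x, y)
   with v continuous. Non-uniqueness comes from an autonomous equation
   z' = beta(z), where beta vanishes on a Cantor set that solutions cross in
   finite time: a second flow of the same equation lets the solutions spend an
   additional time, given by a devil's staircase, on the Cantor set, and the two
   orbits of a suitable zero of beta cross each other there.

   As beta is locally constant on a dense open set, the construction can be
   repeated. Near a point where v does not depend on y, the leaves of both
   families are the vertical translates of one leaf H, and the orbits of the two
   flows are inserted in the coordinate z = y - H(x) of a small box, with time
   replaced by a bump function of x. Doing this in a dense sequence of boxes,
   with perturbations whose sizes are summable and which avoid the finitely many
   leaves through the crossings found so far, gives uniform limits in which all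
   these crossings survive. *)

(** * Real functions *)

Section RealFunctions.
Context {R : realType}.
Implicit Types (f : R -> R) (x y : R).

(** Each family is moved by its own flow, yet both must stay tangent to one field. They do, because
    the slope that an insertion adds involves the flow only through [beta], which [phi] and [psi]
    share. The new field may depend on [y] inside the box, so [beta] has to be flat on a dense set
    and still have two different flows. The staircase [D] is used twice for this: [rho t = t - D t]
    is the delayed clock of [psi], and the speed of the orbit is [D \o w], where the continuous [w]
    vanishes exactly on the image under [rho] of the points outside [G], a dense open set on which
    [D] is locally constant. The outer [D] flattens the speed without changing its zeros. Uniform
    limits respect the differential equation but not strict inequalities, and both the crossings and
    the injectivity in the label are strict inequalities; hence the leaves that carry them must stop
    moving after finitely many stages. At a crossing of the limit only the reversal of order is
    known, not the rate at which the leaves separate, so the transversality chart has to be built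
    from that sign alone. *)

Lemma continuous_atP f x : {for x, continuous f} <->
  forall e, 0 < e -> exists2 d, 0 < d &
    forall y, `|y - x| < d -> `|f y - f x| < e.
Proof.
split=> [fx e e0|fx].
  move/cvgrPdist_lt : fx => /(_ e e0) /nbhs_ballP[d /= d0 dP].
  by exists d => // y yx; rewrite distrC; apply: dP; rewrite /ball/= distrC.
apply/cvgrPdist_lt => e /fx[d d0 dP]; apply/nbhs_ballP; exists d => //= y.
by rewrite /ball/= distrC => /dP; rewrite distrC.
Qed.

(** This division-free form allows [y = x]; changes of time and uniform limits are treated through
    it as plain estimates. *)
Lemma is_deriveP f x l : is_derive x 1 f l <->
  forall e, 0 < e -> exists2 d, 0 < d &
    forall y, `|y - x| < d -> `|f y - f x - l * (y - x)| <= e * `|y - x|.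
Proof.
split=> [[fx <-] e e0|fx].
  move/cvg_ex : (fx) => [k fk].
  have kE : 'D_1 f x = k by exact: cvg_lim fk.
  move/cvgrPdist_lt : fk => /(_ e e0); rewrite near_withinE.
  move=> /nbhs_ballP[d /= d0 dP].
  exists d => // y yx; rewrite kE.
  have [->|xy] := eqVneq y x; first by rewrite !subrr mulr0 subr0 normr0 mulr0.
  have := dP (y - x); rewrite /ball/= sub0r normrN => /(_ yx).
  rewrite subr_eq0 => /(_ xy).
  rewrite /GRing.scale/= mulr1 subrK => /ltW h.
  have yx0 : y - x != 0 by rewrite subr_eq0.
  have -> : f y - f x - k * (y - x) = - ((k - (y - x)^-1 * (f y - f x)) * (y - x)).
    by field.
  by rewrite normrN normrM ler_wpM2r.
suff : (fun h => h^-1 *: (f (h *: 1 + x) - f x)) @ 0^' --> l.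
  move=> fl; split; first by apply/cvg_ex; exists l.
  exact: cvg_lim fl.
apply/cvgrPdist_le => e /fx[d d0 dP]; rewrite near_withinE.
apply/nbhs_ballP; exists d => //= h; rewrite /ball/= sub0r normrN => hd h0.
have := dP (h + x); rewrite addrK => /(_ hd).
rewrite /GRing.scale/= mulr1.
have -> : f (h + x) - f x - l * h = - ((l - h^-1 * (f (h + x) - f x)) * h).
  by field.
by rewrite normrN normrM ler_pM2r// normr_gt0.
Qed.

Lemma is_derive_near f g x l d : 0 < d ->
  (forall y, `|y - x| < d -> f y = g y) -> is_derive x 1 f l ->
  is_derive x 1 g l.
Proof.
move=> d0 fg /is_deriveP fx; apply/is_deriveP => e /fx[c c0 cP].
exists (Num.min c d) => [|y]; first by rewrite lt_min c0.
rewrite lt_min => /andP[yc yd]; rewrite -!fg ?subrr ?normr0//.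
exact: cP.
Qed.

Lemma is_derive_continuous f x l : is_derive x 1 f l -> {for x, continuous f}.
Proof. by move=> [fx _]; exact/differentiable_continuous/derivable1_diffP. Qed.

Lemma MVT_dist f (df : R -> R) x y : (forall t : R, is_derive t 1 f (df t)) ->
  exists2 c, `|c - x| <= `|y - x| & f y - f x = df c * (y - x).
Proof.
move=> fd.
have cf : continuous f by move=> t; exact: is_derive_continuous (fd t).
wlog : x y / x <= y.
  move=> h; have [/h//|/ltW xy] := leP x y.
  have [c cx fE] := MVT_segment xy (fun t _ => fd t) (continuous_subspaceT cf).
  exists c; last by rewrite -opprB fE; ring.
  rewrite !ler0_norm ?subr_le0// ?(itvP cx)//.
  by rewrite lerN2 lerD2r (itvP cx).
move=> xy.
have [c cx fE] := MVT_segment xy (fun t _ => fd t) (continuous_subspaceT cf).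
exists c => //.
by rewrite !ger0_norm ?subr_ge0// ?(itvP cx)// lerD2r (itvP cx).
Qed.

Lemma is_derive0_cst_in f x0 s : (forall t : R, `|t - x0| < s -> is_derive t 1 f 0) ->
  forall x y, `|x - x0| < s -> `|y - x0| < s -> f x = f y.
Proof.
move=> fd x y; wlog xy : x y / x <= y.
  by move=> h; have [/h//|/ltW/h + xI yI] := leP x y => ->.
rewrite !ltr_norml => /andP[x1 x2] /andP[y1 y2].
have {}fd t : x <= t -> t <= y -> is_derive t 1 f 0.
  by move=> xt ty; apply: fd; rewrite ltr_norml; apply/andP; split; lra.
have fd' t : t \in `]x, y[ -> is_derive t 1 f ((fun=> 0) t).
  by move=> txy; apply: fd; rewrite (itvP txy).
have [|c _ /eqP] := MVT_segment xy fd'.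
  apply: continuous_in_subspaceT => t; rewrite inE/= => /itvP txy.
  by apply: (@is_derive_continuous _ _ 0); apply: fd; rewrite txy.
by rewrite mul0r subr_eq0 => /eqP.
Qed.

End RealFunctions.

(** * Bijections preserving the vertical lines *)

Definition jointly_continuous (R : realType) (f : R -> R -> R) :=
  forall x y e, 0 < e -> exists2 d, 0 < d &
    forall x' y', `|x' - x| < d -> `|y' - y| < d ->
      `|f x' y' - f x y| < e.

Definition fibred_bijection (R : realType) (f : R -> R -> R) :=
  [/\ forall x, {homo f x : a b / a < b},
      forall x y, exists c, f x c = y
    & forall c, continuous (f^~ c)].

Section FibredBijections.
Context {R : realType}.
Implicit Types (f P : R -> R -> R).

Lemma jointly_continuousP f :
  jointly_continuous f <-> continuous (fun p : R * R => f p.1 p.2).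
Proof.
split=> [fc [x y]|fc x y e e0].
  apply/cvgrPdist_lt => e /(fc x y)[d d0 dP].
  exists (ball x d, ball y d); first by split; exact: nbhsx_ballx.
  move=> [x' y'] [/=]; rewrite /ball/= => xx yy.
  by rewrite distrC; apply: dP; rewrite distrC.
move/cvgrPdist_lt : (fc (x, y)) => /(_ e e0)[[A B] /= [xA yB] AB].
have [d1 /= d10 d1A] := (nbhs_ballP _ _).1 xA.
have [d2 /= d20 d2B] := (nbhs_ballP _ _).1 yB.
exists (Num.min d1 d2) => [|x' y']; first by rewrite lt_min d10.
rewrite !lt_min => /andP[xd _] /andP[_ yd]; rewrite distrC.
by apply: (AB (x', y')); split; [apply: d1A|apply: d2B]; rewrite /ball/= distrC.
Qed.

Lemma jointly_continuous_comp f (u w : R -> R) x : jointly_continuous f ->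
  {for x, continuous u} -> {for x, continuous w} ->
  {for x, continuous (fun t => f (u t) (w t))}.
Proof.
move=> fc /continuous_atP uc /continuous_atP wc.
apply/continuous_atP => e /(fc (u x) (w x))[d d0 dP].
have [d1 d10 d1P] := uc _ d0; have [d2 d20 d2P] := wc _ d0.
exists (Num.min d1 d2) => [|y]; first by rewrite lt_min d10.
by rewrite lt_min => /andP[y1 y2]; apply: dP; [exact: d1P|exact: d2P].
Qed.

Lemma jointly_continuous_sections f : jointly_continuous f ->
  (forall x, continuous (f x)) /\ (forall y, continuous (f^~ y)).
Proof.
move=> fc; split=> z t.
  by apply: (jointly_continuous_comp fc) => //; exact: cst_continuous.
by apply: (jointly_continuous_comp fc) => //; exact: cst_continuous.
Qed.

Lemma fibred_mono f x : fibred_bijection f -> {mono f x : a b / a < b}.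
Proof. by move=> [fm _ _]; apply/leW_mono/le_mono/fm. Qed.

(** Monotonicity squeezes [f x' y'] between [f x' a] and [f x' b] for fixed [a < y < b], so
    continuity in the base variable at two labels is enough. *)
Lemma fibred_jointly_continuous f : fibred_bijection f -> jointly_continuous f.
Proof.
move=> ff; have [_ fs fc] := ff; move=> x y e e0.
have [a fa] := fs x (f x y - e / 2); have [b fb] := fs x (f x y + e / 2).
have ay : a < y by rewrite -(fibred_mono x ff) fa; lra.
have yb : y < b by rewrite -(fibred_mono x ff) fb; lra.
have e20 : 0 < e / 2 by lra.
have /continuous_atP/(_ _ e20)[d1 d10 d1P] := fc a x.
have /continuous_atP/(_ _ e20)[d2 d20 d2P] := fc b x.
exists (Num.min (Num.min d1 d2) (Num.min (y - a) (b - y))).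
  by rewrite !lt_min d10 d20 !subr_gt0 ay yb.
move=> x' y'; rewrite !lt_min => /andP[/andP[/d1P h1 /d2P h2] _].
move=> /andP[_ /andP[h3 h4]].
have ay' : f x' a < f x' y'.
  by rewrite (fibred_mono x' ff); move: h3; rewrite ltr_norml => /andP[]; lra.
have yb' : f x' y' < f x' b.
  by rewrite (fibred_mono x' ff); move: h4; rewrite ltr_norml => /andP[]; lra.
move: h1 h2; rewrite fa fb !ltr_norml => /andP[h1 _] /andP[_ h2].
by apply/andP; split; lra.
Qed.

(** The inverse is continuous in the base variable because [a < P x' y < b] amounts to
    [f x' a < y < f x' b], which persists when [x'] is close to [x]. *)
Lemma fibred_inverse f : fibred_bijection f -> exists P,
  [/\ forall x, cancel (f x) (P x), forall x, cancel (P x) (f x)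
    & fibred_bijection P].
Proof.
move=> ff; have [fm fs fc] := ff.
pose P x y := projT1 (cid (fs x y)).
have PK x : cancel (P x) (f x) by move=> y; rewrite /P; case: cid.
have fK x : cancel (f x) (P x).
  move=> c; apply: (inc_inj (le_mono (fm x))); exact: PK.
exists P; split => //; split.
- by move=> x a b ab; rewrite -(fibred_mono x ff) !PK.
- by move=> x y; exists (f x y); exact: fK.
- move=> y x; apply/continuous_atP => e e0.
  set a := P x y - e / 2; set b := P x y + e / 2.
  have ay : f x a < y by rewrite -[ltRHS](PK x) (fibred_mono x ff) /a; lra.
  have yb : y < f x b by rewrite -[ltLHS](PK x) (fibred_mono x ff) /b; lra.
  have /continuous_atP/(_ (y - f x a))[|d1 d10 d1P] := fc a x.
    by rewrite subr_gt0.
  have /continuous_atP/(_ (f x b - y))[|d2 d20 d2P] := fc b x.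
    by rewrite subr_gt0.
  exists (Num.min d1 d2) => [|x']; first by rewrite lt_min d10.
  rewrite lt_min => /andP[/d1P + /d2P].
  rewrite !ltr_norml => /andP[_ h1] /andP[h2 _].
  have : f x' a < f x' (P x' y) by rewrite PK; lra.
  have : f x' (P x' y) < f x' b by rewrite PK; lra.
  rewrite !(fibred_mono x' ff) /a /b => h3 h4.
  by apply/andP; split; lra.
Qed.

Lemma fibred_comp f g : fibred_bijection f -> fibred_bijection g ->
  fibred_bijection (fun x c => f x (g x c)).
Proof.
move=> ff gg; have [fm fs fc] := ff; have [gm gs gc] := gg; split.
- by move=> x a b ab; apply/fm/gm.
- move=> x y; have [c <-] := fs x y; have [d <-] := gs x c.
  by exists d.
- move=> c x; apply: (jointly_continuous_comp (fibred_jointly_continuous ff)).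
    exact: cvg_id.
  exact: gc.
Qed.

Lemma strictly_increasing_bijection (f : R -> R) : {homo f : a b / a < b} ->
  (forall y, exists c, f c = y) -> exists g : R -> R,
  [/\ cancel f g, cancel g f, {homo g : a b / a < b}, continuous f
    & continuous g].
Proof.
move=> fm fs; have ff : fibred_bijection (fun=> f).
  by split=> // c; exact: cst_continuous.
have [P [fK PK PP]] := fibred_inverse ff.
have [Pm _ _] := PP.
exists (P 0); split=> //.
  exact: (jointly_continuous_sections (fibred_jointly_continuous ff)).1 0.
exact: (jointly_continuous_sections (fibred_jointly_continuous PP)).1.
Qed.

End FibredBijections.

(** * A staircase over a fat Cantor set *)

Section FatCantorSet.
Context {R : realType}.
Notation mu := (@lebesgue_measure R).

(** An enumeration of the rationals; an index that codes none gives [0], whose ball below is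
    empty. *)
Let q (n : nat) : R := ratr (odflt 0 (unpickle n : option rat)).

(* The radii are proportional to [`|q n|], so that the complement [K] has positive
   measure on each side of [0]. *)
Let I (n : nat) : set R := ball (q n) (`|q n| / (2 ^ n.+3)%:R).

Let K : set R := `[-1, 1]%classic `\` \bigcup_n I n.

Let K_closed : closed K.
Proof.
apply: closedI; first exact: interval_closed.
by apply/open_closedC/bigcup_open => n _; exact: ball_open.
Qed.

Let mK : measurable K. Proof. exact: closed_measurable. Qed.

Let mI n : measurable (I n).
Proof. by apply: open_measurable; exact: ball_open. Qed.

(** A rational lies in the ball removed around it unless it is [0], hence the search for a nonzero
    one. *)
Let KC_dense (a b : R) : a < b -> exists2 x, a < x < b & ~ K x.
Proof.
move=> ab.
have [p p_neq0 pab] : exists2 p : rat, p != 0 & a < ratr p < b.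
  have [p /itvP pab] := rat_in_itvoo ab.
  have [p0|p_neq0] := eqVneq p 0; last by exists p; rewrite // !pab.
  have : ratr p < b by rewrite pab.
  have : a < ratr p by rewrite pab.
  rewrite p0 rmorph0 => a_lt0 /rat_in_itvoo[r /itvP rab].
  exists r; last by rewrite rab andbT (lt_trans a_lt0)// rab.
  apply/eqP => r0; have : 0 < ratr r :> R by rewrite rab.
  by rewrite r0 rmorph0 ltxx.
exists (ratr p) => // -[_]; apply; exists (pickle p) => //.
rewrite /I /q pickleK /=; apply: ballxx; apply: divr_gt0.
  by rewrite normr_gt0 fmorph_eq0.
by rewrite ltr0n expn_gt0.
Qed.

(** The radius of [I n] is at most [|q n| / 8]. If [I n] meets [J], then [|q n| <= 8 / 7 * s], and
    the length of [I n] is at most [4 / 7 * s / 2 ^ n.+1]. These lengths add up to at most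
    [4 / 7 * s], less than the measure [s] of [J]. *)
Let mu_K_gt0 (J : set R) (s : R) : measurable J -> 0 < s ->
  J `<=` `[-1, 1]%classic -> (forall t, J t -> `|t| <= s) -> mu J = s%:E ->
  (0 < mu (K `&` J))%E.
Proof.
move=> mJ s0 J11 Js muJ.
have mIJ n : measurable (I n `&` J) by exact: measurableI.
have muI n : (mu (I n `&` J) <= (4 / 7 * s / (2 ^ n.+1)%:R)%:E)%E.
  have [->|/set0P[t [It Jt]]] := eqVneq (I n `&` J) set0.
    by rewrite measure0 lee_fin; apply: divr_ge0 => //; lra.
  have q0 : 0 <= `|q n| / (2 ^ n.+3)%:R by apply: divr_ge0.
  have e8 : (2 ^ n.+3)%:R = 4 * (2 ^ n.+1)%:R :> R.
    by rewrite -natrM !expnS; congr (_%:R); ring.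
  have e2 : 2 <= (2 ^ n.+1)%:R :> R by rewrite ler_nat expnS -[leqLHS]muln1 leq_mul2l expn_gt0.
  set N : R := (2 ^ n.+1)%:R in e8 e2 *.
  have qs : `|q n| <= 8 / 7 * s.
    have := It; rewrite /I /ball/= e8 => qt.
    have {}qt : `|q n| - s < `|q n| / (4 * (2 ^ n.+1)%:R).
      apply: le_lt_trans qt; apply: le_trans (lerB_dist _ _).
      by rewrite lerD2l lerN2 Js.
    suff : `|q n| / (4 * (2 ^ n.+1)%:R) <= `|q n| / 8 by lra.
    by rewrite ler_wpM2l// lef_pV2 ?posrE; [lra|lra|rewrite ltr0n].
  apply: (@le_trans _ _ (mu (I n))).
    apply: le_measure; rewrite ?inE; last exact: subIsetl.
      exact: mIJ.
    exact: mI.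
  rewrite /I lebesgue_measure_ball// lee_fin e8.
  have N0 : N != 0 by rewrite gt_eqF//; lra.
  rewrite (_ : _ *+ 2 = `|q n| / 2 / N); last by field.
  by rewrite ler_wpM2r ?invr_ge0; lra.
have muU : (mu (\bigcup_n (I n `&` J)) <= (4 / 7 * s)%:E)%E.
  have s47 : 0 <= 4 / 7 * s by lra.
  apply: le_trans (epsilon_trick0 xpredT s47).
  apply: (@le_trans _ _ (\sum_(n <oo) mu (I n `&` J))%E).
    apply: generalized_Boole_inequality => //.
    exact: bigcupT_measurable.
  by apply: lee_nneseries.
have : (mu J <= mu (K `&` J) + mu (\bigcup_n (I n `&` J)))%E.
  apply: le_trans (measureU2 _ _ _).
  - apply: le_measure; rewrite ?inE//.
      by apply: measurableU; [exact: measurableI|exact: bigcupT_measurable].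
    move=> t Jt; have [[n _ It]|nIt] := pselect ((\bigcup_n I n) t).
      by right; exists n.
    by left; split=> //; split=> //; exact: J11.
  - exact: measurableI.
  - exact: bigcupT_measurable.
rewrite muJ => sle; rewrite lt_neqAle measure_ge0 andbT; apply/eqP => mu0.
move: (le_trans sle (leeD2l _ muU)).
by rewrite -mu0 add0e lee_fin; lra.
Qed.

Let m (A : set R) : R := fine (mu (K `&` A)).

Let mu_fin (A : set R) : measurable A -> mu (K `&` A) = (m A)%:E.
Proof.
move=> mA; rewrite fineK// ge0_fin_numE//.
apply: (@le_lt_trans _ _ (mu (`[-1, 1]%classic : set R))).
  apply: le_measure; rewrite ?inE; [exact: measurableI|exact: measurable_itv|].
  by move=> t [[]].
by rewrite lebesgue_measure_itv/=; case: ifP => _; rewrite ?ltry.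
Qed.

Let mB (x y : R) : x <= y -> m `]-oo, y] - m `]-oo, x] = m `]x, y].
Proof.
move=> xy; suff -> : m `]-oo, y] = m `]-oo, x] + m `]x, y] by ring.
have disj : (K `&` `]-oo, x]) `&` (K `&` `]x, y]) = set0.
  apply/seteqP; split=> // t [[_ tx] [_]]; move: tx.
  rewrite /= !in_itv/= => tx /andP[/lt_geF]; by rewrite tx.
have U : `]-oo, y]%classic = `]-oo, x] `|` `]x, y].
  by rewrite -itv_bndbnd_setU ?bnd_simp.
have : mu (K `&` `]-oo, y]) = (mu (K `&` `]-oo, x]) + mu (K `&` `]x, y]))%E.
  by rewrite U setIUr measureU//; apply: measurableI => //; exact: measurable_itv.
by rewrite !mu_fin// -EFinD => -[].
Qed.

(** [D] is the distribution function of Lebesgue measure restricted to [K], normalised at [0], and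
    [O] is the complement of [K]. The sign of [D] on each side of [0] comes from the positive
    measure of [K] there. *)
Lemma cantor_staircase : exists (O : set R) (D : R -> R),
  [/\ open O,
      forall a b, a < b -> exists2 x, a < x < b & O x,
      forall x, O x -> exists2 d, 0 < d &
        forall y, `|y - x| < d -> D y = D x,
      forall x y, x <= y -> 0 <= D y - D x <= y - x
    & [/\ D 0 = 0, forall x, 0 < x -> 0 < D x, forall x, x < 0 -> D x < 0
         & forall x, `|D x| <= 1]].
Proof.
pose D x := m `]-oo, x] - m `]-oo, 0].
have DB x y : x <= y -> D y - D x = m `]x, y].
  by move=> /mB <-; rewrite /D; ring.
have m_ge0 A : 0 <= m A by exact: fine_ge0.
have m_le (A B : set R) : measurable A -> measurable B ->
    K `&` A `<=` B -> m A <= m B.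
  move=> mA mB' AB; rewrite -lee_fin -!mu_fin//; apply: le_measure; rewrite ?inE.
  - exact: measurableI.
  - exact: measurableI.
  - by move=> t [Kt At]; split=> //; exact: AB.
have m_le_length x y : x <= y -> m `]x, y] <= y - x.
  move=> xy; rewrite -lee_fin -mu_fin//.
  apply: (@le_trans _ _ (mu `]x, y]%classic)).
    apply: le_measure; rewrite ?inE; last exact: subIsetr.
      exact: measurableI.
    exact: measurable_itv.
  rewrite lebesgue_measure_itv/= lte_fin; case: ifPn => // _.
  by rewrite lee_fin subr_ge0.
have D0 : D 0 = 0 by rewrite /D subrr.
have Dmono x y : x <= y -> 0 <= D y - D x.
  by move=> /DB ->; exact: m_ge0.
have pos01 x : 0 < x -> x <= 1 -> 0 < D x.
  move=> x0 x1; have := DB _ _ (ltW x0); rewrite D0 subr0 => ->.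
  rewrite -lte_fin -mu_fin//; apply: (mu_K_gt0 _ x0) => //.
  - by move=> t /=; rewrite !in_itv/= => /andP[t0 tx]; apply/andP; split; lra.
  - by move=> t /=; rewrite !in_itv/= => /andP[t0 tx]; rewrite ger0_norm// ltW.
  - by rewrite lebesgue_measure_itv/= lte_fin x0 sube0.
have neg01 x : x < 0 -> -1 <= x -> D x < 0.
  move=> x0 x1; have := DB _ _ (ltW x0); rewrite D0 sub0r -oppr_gt0 => ->.
  have Nx0 : 0 < - x by rewrite oppr_gt0.
  rewrite -lte_fin -mu_fin//; apply: (mu_K_gt0 _ Nx0) => //.
  - by move=> t /=; rewrite !in_itv/= => /andP[t0 tx]; apply/andP; split; lra.
  - by move=> t /=; rewrite !in_itv/= => /andP[t0 tx]; rewrite ler0_norm// lerN2 ltW.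
  - by rewrite lebesgue_measure_itv/= lte_fin x0 EFinN sub0e.
have up1 x : 1 <= x -> D x = D 1.
  move=> x1; apply/eqP; rewrite -subr_eq0 DB// eq_le m_ge0 andbT.
  have <- : m set0 = 0 by rewrite /m setI0 measure0.
  apply: m_le => // t [[/= + _]]; rewrite !in_itv/= => /andP[_ t1].
  by move=> /andP[/lt_geF]; rewrite t1.
have dn1 x : x <= -1 -> D x = D (- 1).
  move=> x1; apply/eqP; rewrite eq_sym -subr_eq0 DB// eq_le m_ge0 andbT.
  have mN1 : m [set -1] <= 0.
    rewrite -lee_fin -mu_fin; last exact: measurable_set1.
    have -> : 0%:E = mu [set -1] by rewrite lebesgue_measure_set1.
    apply: le_measure; rewrite ?inE.
    - by apply: measurableI => //; exact: measurable_set1.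
    - exact: measurable_set1.
    - exact: subIsetr.
  apply: le_trans mN1; apply: m_le => //.
  move=> t [[/= + _]]; rewrite !in_itv/= => /andP[t1 _].
  by move=> /andP[_ t2]; apply/eqP; rewrite eq_le t1 t2.
have Dcst x y : x <= y -> (forall z, x < z <= y -> ~ K z) -> D y = D x.
  move=> xy xyK; apply/eqP; rewrite -subr_eq0 DB// eq_le m_ge0 andbT.
  have <- : m set0 = 0 by rewrite /m setI0 measure0.
  by apply: m_le => // t [Kt /=]; rewrite in_itv/= => /xyK.
exists (~` K), D; split=> //.
- exact: closed_openC.
- move=> x Ox.
  have : open (~` K) by exact: closed_openC.
  rewrite openE => /(_ x Ox)/nbhs_ballP[d /= d0 dK]; exists d => // y.
  move=> yxd; have [xy|/ltW yx] := leP x y.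
    apply: Dcst => // z /andP[xz zy]; apply: dK.
    rewrite /ball/= ltr0_norm ?subr_lt0//; apply: le_lt_trans yxd.
    by apply: le_trans (ler_norm _); lra.
  apply/esym/Dcst => // z /andP[yz zx]; apply: dK.
  rewrite /ball/= ger0_norm ?subr_ge0//; apply: le_lt_trans yxd.
  by rewrite distrC; apply: le_trans (ler_norm _); lra.
- by move=> x y xy; rewrite Dmono// DB// m_le_length.
- have D1 := m_le_length 0 1 ler01; have DN1 := m_le_length (-1) 0 _.
  split=> //.
  + move=> x x0; have [/pos01->//|/ltW/up1->] := leP x 1.
    exact: pos01.
  + move=> x x0; have [/neg01->//|/ltW/dn1->] := leP (-1) x.
    by apply: neg01 => //; lra.
  + move=> x; have [/up1->|x1] := leP 1 x.
      have := DB 0 1 ler01; rewrite D0 subr0 => ->.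
      by rewrite ger0_norm//; lra.
    have [/dn1->|x2] := leP x (-1).
      have N10 : (-1 : R) <= 0 by lra.
      have := DB _ _ N10; rewrite D0 sub0r => DE; rewrite -normrN DE.
      by rewrite ger0_norm//; move: (DN1 N10); lra.
    have [x0|/ltW x0] := leP 0 x.
      have := DB 0 x x0; rewrite D0 subr0 => ->.
      by rewrite ger0_norm//; move: (m_le_length 0 x x0); lra.
    have := DB x 0 x0; rewrite D0 sub0r => DE; rewrite -normrN DE.
    by rewrite ger0_norm//; move: (m_le_length x 0 x0); lra.
Qed.

End FatCantorSet.

(** * Two flows of the same field *)

Section Primitive.
Context {R : realType}.

(** The normal density is an integrable majorant of total mass [1], so the integral of [b] from
    [-oo] exists and stays in [[0, 1]]. *)
Lemma bounded_primitive (b : R -> R) : continuous b ->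
  (forall t, 0 <= b t <= normal_pdf 0 1 t) ->
  exists B : R -> R,
    [/\ forall t : R, is_derive t 1 B (b t), B 0 = 0 & forall t, `|B t| <= 1].
Proof.
move=> cb bN.
pose mu := @lebesgue_measure R.
have mb : measurable_fun setT b by exact: continuous_measurable_fun.
have ib : mu.-integrable setT (EFin \o b).
  apply: (le_integrable _ _ _ (integrable_normal_pdf 0 1)) => //.
  - exact/measurable_EFinP.
  - move=> t _ /=; rewrite lee_fin; have /andP[b0 bp] := bN t.
    by rewrite !ger0_norm// (le_trans b0).
have iby (u : R) : mu.-integrable `]-oo, u] (EFin \o b).
  exact: (integrableS _ _ (@subsetT _ _) ib).
pose F (x : R) := (\int[mu]_(t in `]-oo, x]) b t).
have F01 x : 0 <= F x <= 1.
  rewrite Rintegral_ge0 => [/=|t _]; last by case/andP: (bN t).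
  rewrite /F /Rintegral -lee_fin fineK.
    rewrite -(integral_normal_pdf 0 1).
    apply: (@le_trans _ _ (\int[mu]_x (b x)%:E)%E).
      apply: ge0_subset_integral => //; first exact/measurable_EFinP.
      by move=> t _; rewrite lee_fin; case/andP: (bN t).
    apply: ge0_le_integral => //.
    - by move=> t _; rewrite lee_fin; case/andP: (bN t).
    - exact/measurable_EFinP.
    - by apply/measurable_EFinP; exact: measurable_normal_pdf.
    - by move=> t _; rewrite lee_fin; case/andP: (bN t).
  exact: integrable_fin_num.
have FD (x : R) : is_derive x 1 F (b x).
  have xx1 : x < x + 1 by rewrite ltrDl.
  have [d1 d2] := continuous_FTC1 xx1 (iby _) (ltNyr _) (cb x).
  by apply: DeriveDef; [exact: d1|rewrite -derive1E; exact: d2].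
exists (fun t => F t - F 0); split=> [t||t].
- have -> : b t = b t - 0 by rewrite subr0.
  exact: is_deriveB.
- by rewrite subrr.
- have /andP[h1 h2] := F01 t; have /andP[h3 h4] := F01 0.
  by rewrite ler_norml; apply/andP; split; lra.
Qed.

End Primitive.

(** Fixing all [z] with [1 <= |z|] allows a rescaled copy to be glued to the identity outside a
    strip. *)
Definition complete_flow (R : realType) (beta : R -> R) (chi : R -> R -> R) :=
  [/\ fibred_bijection chi,
      forall z t : R, is_derive t 1 (chi^~ z) (beta (chi t z)),
      forall z, chi 0 z = z
    & forall t z, 1 <= `|z| -> chi t z = z].

Definition densely_locally_constant (R : realType) (f : R -> R) :=
  forall a b, a < b -> exists2 x, a < x < b & exists2 d, 0 < d &
    forall y, `|y - x| < d -> f y = f x.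

Section Flows.
Context {R : realType}.

Lemma intermediate_value (f : R -> R) x y v : continuous f ->
  f x <= v <= f y -> exists2 t, Num.min x y <= t <= Num.max x y & f t = v.
Proof.
move=> cf /andP[xv vy].
have [xy|/ltW yx] := leP x y.
  have [|t /itvP txy <-] := IVT xy (continuous_subspaceT cf) (v := v).
    by rewrite ge_min le_max xv vy orbT.
  by exists t; rewrite // !txy.
have [|t /itvP txy <-] := IVT yx (continuous_subspaceT cf) (v := v).
  by rewrite ge_min le_max xv vy orbT.
by exists t; rewrite // !txy.
Qed.

(** Time is translated along the single orbit [B] and every other point is fixed. Order is preserved
    because the range of [B] is an interval: an orbit point that overtook a fixed point would, by
    the intermediate value theorem, pass through it. *)
Lemma flow_of_solution (beta B : R -> R) : {homo B : s t / s < t} ->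
  (forall t : R, is_derive t 1 B (beta (B t))) -> (forall t, `|B t| < 1) ->
  (forall z, (forall t, B t != z) -> beta z = 0) ->
  exists2 chi, complete_flow beta chi & forall s t, chi s (B t) = B (s + t).
Proof.
move=> Bm dB B1 beta0.
have Bmono := leW_mono (le_mono Bm).
have cB : continuous B by move=> t; exact: is_derive_continuous (dB t).
pose chi s z := if pselect (exists t, B t = z) is left tz
  then B (s + projT1 (cid tz)) else z.
have chiB s t : chi s (B t) = B (s + t).
  rewrite /chi; case: pselect => [tz|[]]; last by exists t.
  by case: cid => /= u /(inc_inj (le_mono Bm)) ->.
have chiN s z : (forall t, B t != z) -> chi s z = z.
  move=> zN; rewrite /chi; case: pselect => // tz; exfalso.
  by have [t /eqP] := tz; rewrite (negPf (zN t)).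
have chiP z : (exists t, z = B t) \/ (forall t, B t != z).
  have [[t tz]|zN] := pselect (exists t, B t = z); first by left; exists t.
  by right=> t; apply/eqP => tz; apply: zN; exists t.
have chiD z (t : R) : is_derive t 1 (chi^~ z) (beta (chi t z)).
  have [[u ->{z}]|zN] := chiP z.
    rewrite chiB; apply/is_deriveP => e e0.
    have /is_deriveP/(_ e e0)[d d0 dP] := dB (t + u).
    exists d => // s st; have := dP (s + u).
    rewrite !chiB; have -> : s + u - (t + u) = s - t by ring.
    by apply.
  rewrite chiN// beta0//; apply: (@is_derive_near _ (cst z) _ _ _ 1) => //.
  by move=> y _; rewrite chiN.
exists chi => //; split=> //.
- split=> [s a b ab|s y|z t]; last exact: is_derive_continuous (chiD z t).
    have [[u au]|aN] := chiP a; have [[w bw]|bN] := chiP b.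
    - by rewrite au bw !chiB !Bmono ltrD2l -Bmono -au -bw.
    - rewrite au chiB (chiN _ b)//; have [//|bB] := ltP (B (s + u)) b.
      have [|t _ tb] := @intermediate_value B u (s + u) b cB.
        by rewrite -au (ltW ab).
      by have := bN t; rewrite tb eqxx.
    - rewrite bw chiB (chiN _ a)//; have [//|aB] := ltP a (B (s + w)).
      have [|t _ ta] := @intermediate_value B (s + w) w a cB.
        by rewrite -bw (ltW ab) aB.
      by have := aN t; rewrite ta eqxx.
    - by rewrite !chiN.
  have [[u ->]|yN] := chiP y; last by exists y; rewrite chiN.
  by exists (B (u - s)); rewrite chiB; congr B; ring.
- move=> z; have [[u ->]|zN] := chiP z; last by rewrite chiN.
  by rewrite chiB add0r.
- move=> t z z1; rewrite chiN// => s; apply/eqP => sz.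
  by move: z1; rewrite leNgt -sz B1.
Qed.

Lemma distance_to_closed (O : set R) : open O -> exists u : R -> R,
  [/\ continuous u, forall x, 0 <= u x, forall x, ~ O x -> u x = 0
    & forall x, O x -> 0 < u x].
Proof.
move=> oO; have [[k0 k0O]|allO] := pselect (exists k, ~ O k); last first.
  exists (fun=> 1); split=> //; first exact: cst_continuous.
  by move=> x xO; exfalso; apply: allO; exists x.
pose S x := [set `|x - k| | k in ~` O].
have S0 x : S x !=set0 by exists `|x - k0|; exists k0.
have Slb x : lbound (S x) 0 by move=> _ [k _ <-].
have Sinf x : has_inf (S x) by split=> //; exists 0.
pose u x := inf (S x).
have u_ge0 x : 0 <= u x by exact: lb_le_inf.
have u_le x k : ~ O k -> u x <= `|x - k|.
  by move=> kO; apply: ge_inf; [exists 0|exists k].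
have u_lip x y : u y <= u x + `|y - x|.
  rewrite -lerBlDr; apply: lb_le_inf => // _ [k kO <-].
  rewrite lerBlDr; apply: le_trans (u_le y k kO) _.
  by rewrite (_ : y - k = (x - k) + (y - x)) ?ler_normD//; ring.
exists u; split=> // [x|x xO|x xO].
- apply/continuous_atP => e e0; exists e => // y yx.
  rewrite ltr_norml; move: (u_lip x y) (u_lip y x).
  by rewrite (distrC x) => h1 h2; apply/andP; split; lra.
- by apply/eqP; rewrite eq_le u_ge0 andbT -(normr0 R) -(subrr x) u_le.
- move: oO; rewrite openE => /(_ x xO)/nbhs_ballP[d /= d0 dO].
  apply: lt_le_trans d0 _; apply: lb_le_inf => // _ [k kO <-].
  by rewrite leNgt; apply/negP => /dO.
Qed.

End Flows.

Section TwinFlows.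
Context {R : realType}.

(* The two flows run along the same autonomous field [beta], but [psi] needs the
   extra time [D] to cross the zeros of [beta], a Cantor set of positive measure
   in the time scale of [psi]. *)
Lemma twin_flows : exists (beta : R -> R) (phi psi : R -> R -> R),
  [/\ continuous beta, forall z, `|beta z| <= 1,
      densely_locally_constant beta, complete_flow beta phi
    & complete_flow beta psi /\
      [/\ forall t, 0 < t -> psi t 0 < phi t 0
        & forall t, t < 0 -> phi t 0 < psi t 0]].
Proof.
have [G [D [oG G_dense DG DL [D0 Dp Dn D1]]]] := @cantor_staircase R.
have DLip x y : `|D y - D x| <= `|y - x|.
  wlog xy : x y / x <= y.
    move=> h; have [/h//|/ltW yx] := leP x y.
    by rewrite distrC (distrC y); exact: h.
  by have /andP[? ?] := DL x y xy; rewrite !ger0_norm// subr_ge0.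
have cD : continuous D.
  move=> x; apply/continuous_atP => e e0; exists e => // y.
  exact: le_lt_trans.
(* The clock of [psi]: it runs at unit speed on [G] and is late by [D]. It still increases strictly,
   since [D] is constant on some interval inside any given one. *)
pose rho t := t - D t.
have rho_mono : {homo rho : s t / s < t}.
  move=> s t st; have [x /andP[sx xt] Gx] := G_dense _ _ st.
  have [d d0 dD] := DG x Gx.
  pose y := x + Num.min (d / 2) (t - x).
  have m0 : 0 < Num.min (d / 2) (t - x) by rewrite lt_min subr_gt0 xt andbT; lra.
  have md : Num.min (d / 2) (t - x) <= d / 2 by rewrite ge_min lexx.
  have mt : Num.min (d / 2) (t - x) <= t - x by rewrite ge_min lexx orbT.
  have Dy : D y = D x.
    by apply: dD; rewrite /y addrC addKr ger0_norm; lra.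
  have /andP[_ h1] := DL s x (ltW sx).
  have yt : y <= t by rewrite /y; lra.
  have /andP[_ h2] := DL y t yt.
  by rewrite /rho; move: h2; rewrite Dy /y; lra.
have rho_le s t : (rho s <= rho t) = (s <= t) by exact: (le_mono rho_mono).
have c_rho : continuous rho.
  by move=> x; apply: cvgB; [exact: cvg_id|exact: cD].
have rho_surj z : exists t, rho t = z.
  have [|t _ <-] := @intermediate_value _ rho (z - 1) (z + 1) z c_rho;
    last by exists t.
  rewrite /rho.
  by have := D1 (z - 1); have := D1 (z + 1); rewrite !ler_norml;
    move=> /andP[? ?] /andP[? ?]; apply/andP; split; lra.
have [sigma [rhoK sigmaK sigma_mono _ c_sigma]] :=
  strictly_increasing_bijection rho_mono rho_surj.
have [u [cu u_ge0 uN up]] := distance_to_closed oG.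
(* The first term places the zeros, the second bounds the primitive, and the third gives an explicit
   decay, used for the continuity of [beta] at the ends of the orbit. *)
pose w t := Num.min (u (sigma t)) (Num.min (normal_pdf 0 1 t) (1 + `|t|)^-1).
have inv_gt0 (t : R) : 0 < (1 + `|t|)^-1 by rewrite invr_gt0 ltr_wpDr.
have pdf_gt0 (t : R) : 0 < normal_pdf 0 1 t.
  by rewrite normal_pdfE ?oner_neq0// mulr_gt0 ?expR_gt0// normal_peak_gt0// oner_neq0.
have w_ge0 t : 0 <= w t by rewrite /w !le_min u_ge0 !ltW.
have w_gt0 t : G (sigma t) -> 0 < w t.
  by move=> /up ut; rewrite /w !lt_min ut pdf_gt0 inv_gt0.
have w0 t : ~ G (sigma t) -> w t = 0.
  move=> /uN ut; apply/eqP; rewrite eq_le w_ge0 andbT /w ut.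
  by rewrite ge_min lexx.
have cw : continuous w.
  have c1 : continuous (fun t : R => (1 + `|t|)^-1).
    move=> t; apply: cvgV; first by rewrite gt_eqF// ltr_wpDr.
    by apply: cvgD; [exact: cvg_cst|exact: norm_continuous].
  have c2 : continuous (@normal_pdf R 0 1).
    by apply: continuous_normal_pdf; exact: oner_neq0.
  move=> t; apply: (@continuous_min R R (u \o sigma)
    (fun t => Num.min (normal_pdf 0 1 t) (1 + `|t|)^-1)).
    exact: (continuous_comp (c_sigma t) (cu _)).
  apply: (@continuous_min R R (normal_pdf 0 1) (fun t => (1 + `|t|)^-1)).
    exact: c2.
  exact: c1.
(* [D] vanishes only at [0], so [b] has the zeros of [w], and [b] is locally constant wherever [w]
   takes a value in [G]. *)
pose b t := D (w t).
have cb : continuous b by move=> t; exact: (continuous_comp (cw t) (cD _)).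
have b_ge0 t : 0 <= b t by have /andP[+ _] := DL 0 (w t) (w_ge0 t); rewrite D0 subr0.
have b_le t : b t <= w t.
  by have /andP[_ +] := DL 0 (w t) (w_ge0 t); rewrite D0 !subr0.
have b_gt0 t : G (sigma t) -> 0 < b t by move=> /w_gt0/Dp.
have b0 t : ~ G (sigma t) -> b t = 0 by rewrite /b => /w0 ->.
have b_const : densely_locally_constant b.
  move=> s t st; pose m := (s + t) / 2.
  (* If [w] takes two values on the interval, it also takes one in the dense set [G], near which [D]
     is constant; otherwise [w] itself is constant there. *)
  have [[x [sx xt wx]]|w_cst] := pselect (exists x, [/\ s < x, x < t & w x != w m]).
    have [v /andP[wv vw] Gv] : exists2 v, Num.min (w x) (w m) < v < Num.max (w x) (w m) & G v.
      by apply: G_dense; rewrite gt_min !lt_max !ltxx; case: (ltgtP (w x)) wx.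
    have [y + wy] : exists2 y, Num.min x m <= y <= Num.max x m & w y = v.
      case: (ltgtP (w x) (w m)) wx wv vw => // _ _ wv vw.
        by apply: intermediate_value => //; rewrite !ltW.
      by rewrite minC maxC; apply: intermediate_value => //; rewrite !ltW.
    rewrite ge_min le_max => /andP[my ym].
    exists y.
      move: my ym; rewrite /m; clear -sx xt => /orP[?|?] /orP[?|?];
        by apply/andP; split; lra.
    rewrite -wy in Gv; have [d d0 dD] := DG _ Gv.
    have /continuous_atP/(_ d d0)[c c0 cP] := cw y.
    by exists c => // z /cP /dD.
  exists m; first by rewrite /m; apply/andP; split; lra.
  exists ((t - s) / 2); first lra.
  move=> y ym; have [wy|wy] := eqVneq (w y) (w m); first by rewrite /b wy.
  exfalso; apply: w_cst; exists y; split=> //.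
    by move: ym; rewrite ltr_norml /m => /andP[]; lra.
  by move: ym; rewrite ltr_norml /m => /andP[]; lra.
have [B [dB B0 B_le1]] : exists B : R -> R,
    [/\ forall t : R, is_derive t 1 B (b t), B 0 = 0 & forall t, `|B t| <= 1].
  apply: bounded_primitive => // t; rewrite b_ge0 (le_trans (b_le t))//.
  by rewrite /w ge_min ge_min lexx orbT.
have cB : continuous B by move=> t; exact: is_derive_continuous (dB t).
have B_ndecr s t : s <= t -> B s <= B t.
  move=> st; have [c _ BE] := MVT_dist s t dB.
  by rewrite -subr_ge0 BE mulr_ge0// subr_ge0.
have B_mono : {homo B : s t / s < t}.
  move=> s t st; have /sigma_mono/G_dense[g /andP[sg gt] Gg] := st.
  pose x := rho g.
  have sx : s < x by rewrite /x -(sigmaK s); exact: rho_mono.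
  have xt : x < t by rewrite /x -(sigmaK t); exact: rho_mono.
  have bx : 0 < b x by apply: b_gt0; rewrite /x rhoK.
  have bx2 : 0 < b x / 2 by lra.
  have /is_deriveP/(_ _ bx2)[d d0 dP] := dB x.
  pose h := Num.min (d / 2) (t - x).
  have h0 : 0 < h by rewrite lt_min subr_gt0 xt andbT; lra.
  have hd : h <= d / 2 by rewrite ge_min lexx.
  have ht : h <= t - x by rewrite ge_min lexx orbT.
  have := dP (x + h); rewrite (addrC x) addrK gtr0_norm// => dPh.
  have /dPh{dPh} : h < d by lra.
  rewrite ler_norml => /andP[h1 _].
  apply: (le_lt_trans (B_ndecr s x (ltW sx))).
  apply: (lt_le_trans _ (B_ndecr (h + x) t _)); last lra.
  by have := mulr_gt0 bx2 h0; lra.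
have BK := leW_mono (le_mono B_mono).
have B_lt1 t : `|B t| < 1.
  have h1 : B t < B (t + 1) by rewrite BK; lra.
  have h2 : B (t - 1) < B t by rewrite BK; lra.
  have := B_le1 (t + 1); have := B_le1 (t - 1).
  by rewrite !ler_norml ltr_norml => /andP[? ?] /andP[? ?]; apply/andP; split; lra.
have B_open t d : 0 < d -> exists2 e, 0 < e &
    forall z, `|z - B t| < e -> exists2 y, `|y - t| < d & B y = z.
  move=> d0.
  have h1 : B t < B (t + d) by rewrite BK; lra.
  have h2 : B (t - d) < B t by rewrite BK; lra.
  exists (Num.min (B (t + d) - B t) (B t - B (t - d))).
    by rewrite lt_min !subr_gt0 h1.
  move=> z; rewrite lt_min !ltr_norml => /andP[/andP[h3 h4] /andP[h5 h6]].
  have [||y _ yz] := @intermediate_value _ B (t - d) (t + d) z => //.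
    by apply/andP; split; lra.
  exists y => //; rewrite ltr_norml.
  have : B (t - d) < B y by rewrite yz; lra.
  have : B y < B (t + d) by rewrite yz; lra.
  by rewrite !BK; clear => ? ?; apply/andP; split; lra.
pose beta z := if pselect (exists t, B t = z) is left tz
  then b (projT1 (cid tz)) else 0.
have betaB t : beta (B t) = b t.
  rewrite /beta; case: pselect => [tz|[]]; last by exists t.
  by case: cid => /= y /(inc_inj (le_mono B_mono)) ->.
have betaN z : ~ (exists t, B t = z) -> beta z = 0.
  by rewrite /beta; case: pselect.
have b_small e t : 0 < e -> e^-1 < `|t| -> b t < e.
  move=> e0 et; apply: (le_lt_trans (b_le t)).
  apply: (@le_lt_trans _ _ (1 + `|t|)^-1).
    by rewrite /w !ge_min lexx !orbT.
  have t10 : 0 < 1 + `|t| by rewrite ltr_wpDr.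
  by rewrite invf_plt ?posrE//; lra.
exists beta.
have c_beta : continuous beta.
  move=> z; apply/continuous_atP => e e0.
  have [[t <-]|zN] := pselect (exists t, B t = z).
    have /continuous_atP/(_ e e0)[d d0 dP] := cb t.
    have [c c0 cP] := B_open t d d0.
    by exists c => // y /cP[x /dP + <-]; rewrite !betaB.
  (* Here [z] lies beyond an end of the orbit. With [L = e^-1], every orbit point near [z] is some
     [B x] with [|x| > L], where [b x < e]. *)
  rewrite (betaN z)//.
  pose L := e^-1; have L0 : 0 < L by rewrite invr_gt0.
  have [zL|zL] := ltP z (B L); last first.
    exists (z - B L).
      by rewrite subr_gt0 lt_neqAle zL andbT; apply/eqP => zBL; apply: zN; exists L.
    move=> y; rewrite ltr_norml => /andP[yz _].
    have [[x xy]|yN] := pselect (exists t, B t = y); last first.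
      by rewrite betaN// subr0 normr0.
    have : B L < B x by rewrite xy; lra.
    rewrite BK => Lx; rewrite -xy betaB subr0 ger0_norm//; apply: b_small => //.
    by rewrite gtr0_norm//; exact: lt_trans Lx.
  have zNL : z < B (- L).
    rewrite ltNge; apply/negP => NLz; apply: zN.
    have [|t _ <-] := @intermediate_value _ B (- L) L z cB; last by exists t.
    by rewrite NLz ltW.
  exists (B (- L) - z); first by rewrite subr_gt0.
  move=> y; rewrite ltr_norml => /andP[_ yz].
  have [[x xy]|yN] := pselect (exists t, B t = y); last first.
    by rewrite betaN// subr0 normr0.
  have : B x < B (- L) by rewrite xy; lra.
  rewrite BK => Lx; rewrite -xy betaB subr0 ger0_norm//; apply: b_small => //.
  by clear -Lx L0; rewrite ltr0_norm -/L; lra.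
have beta_const : densely_locally_constant beta.
  move=> a c ac.
  have [[t /andP[aBt Btc]]|noB] := pselect (exists t, a < B t < c); last first.
    have N z : a < z < c -> beta z = 0.
      by move=> azc; apply: betaN => -[t tz]; apply: noB; exists t; rewrite tz.
    exists ((a + c) / 2); first by apply/andP; split; lra.
    exists ((c - a) / 2); first lra.
    move=> y; rewrite ltr_norml => /andP[h1 h2].
    by rewrite !N//; clear -ac h1 h2; apply/andP; split; lra.
  have e0 : 0 < Num.min (B t - a) (c - B t) by rewrite lt_min !subr_gt0 aBt.
  have /continuous_atP/(_ _ e0)[d d0 dP] := cB t.
  have [|x xtd [d' d'0 d'P]] := b_const (t - d) (t + d); first lra.
  have [e' e'0 e'P] := B_open x d' d'0.
  exists (B x).
    have xt : `|x - t| < d.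
      rewrite ltr_norml; case/andP: xtd; clear => ? ?.
      by apply/andP; split; lra.
    have := dP x xt; rewrite lt_min !ltr_norml.
    by clear => /andP[/andP[? ?] /andP[? ?]]; apply/andP; split; lra.
  by exists e' => // y /e'P[z /d'P + <-]; rewrite !betaB.
have beta_le1 z : `|beta z| <= 1.
  have [[t <-]|zN] := pselect (exists t, B t = z); first by rewrite betaB D1.
  by rewrite betaN// normr0.
have [|||phi phi_flow phiE] := @flow_of_solution _ beta B B_mono => //.
- by move=> t; rewrite betaB.
- by move=> z zN; apply: betaN => -[t tz]; have := zN t; rewrite tz eqxx.
(* The delayed orbit solves the same equation. Near a point of [G], [rho] is a translation; off [G]
   the speed [b (rho t)] is [0], and since [rho] is 1-Lipschitz the derivative stays [0]. *)
have dB2 (t : R) : is_derive t 1 (B \o rho) (b (rho t)).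
  apply/is_deriveP => e e0.
  have /is_deriveP/(_ e e0)[d d0 dP] := dB (rho t).
  have rho_lip y : `|rho y - rho t| <= `|y - t|.
    have [ty|/ltW yt] := leP t y.
      have /andP[? _] := DL t y ty.
      by rewrite !ger0_norm ?subr_ge0 ?rho_le// /rho; lra.
    have /andP[? _] := DL y t yt.
    by rewrite !ler0_norm ?subr_le0 ?rho_le// /rho; lra.
  have [c c0 cP] : exists2 c, 0 < c & forall y, `|y - t| < c ->
      b (rho t) * (rho y - rho t) = b (rho t) * (y - t).
    have [/DG[c c0 cP]|tN] := pselect (G t); last first.
      by exists 1 => // y _; rewrite b0 ?mul0r// rhoK.
    by exists c => // y /cP Dyt; rewrite /rho Dyt; congr (_ * _); ring.
  exists (Num.min c d) => [|y]; first by rewrite lt_min c0.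
  rewrite lt_min => /andP[/cP <- yd]; apply: (le_trans (dP _ _)).
    exact: le_lt_trans (rho_lip y) yd.
  by rewrite ler_wpM2l// ltW.
have [||||psi psi_flow psiE] := @flow_of_solution _ beta (B \o rho).
- by move=> s t st; apply/B_mono/rho_mono.
- by move=> t /=; rewrite betaB.
- by move=> t; exact: B_lt1.
- move=> z zN; apply: betaN => -[t tz].
  by have := zN (sigma t); rewrite /= sigmaK tz eqxx.
have phi0 t : phi t 0 = B t by rewrite -[in LHS]B0 phiE addr0.
have psi0 t : psi t 0 = B (rho t).
  have -> : 0 = (B \o rho) 0 by rewrite /= /rho D0 subr0.
  by rewrite psiE addr0.
exists phi, psi; split=> //; split=> //; split=> t t0; rewrite phi0 psi0 BK /rho.
  by have := Dp t t0; lra.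
by have := Dn t t0; lra.
Qed.

End TwinFlows.

(** * Twisting solutions in a strip *)

Definition solution_family (R : realType) (v f : R -> R -> R) :=
  fibred_bijection f /\
  forall c x : R, is_derive x 1 (f^~ c) (v x (f x c)).

Definition densely_vertically_constant (R : realType) (v : R -> R -> R) :=
  forall x y e, 0 < e -> exists x0 y0,
    [/\ `|x0 - x| < e, `|y0 - y| < e & exists2 r, 0 < r &
      forall t z w, `|t - x0| < r -> `|z - y0| < r -> `|w - y0| < r ->
        v t z = v t w].

Section Bump.
Context {R : realType}.

(** A cut-off with a continuous derivative: it gives both the bump and the conserved quantity that
    confines solutions to a strip. *)
Lemma is_derive_sqr_pos_part (u : R) :
  is_derive u 1 (fun u => Num.max 0 u ^+ 2) (2 * Num.max 0 u).
Proof.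
apply/is_deriveP => e e0; exists e => // y yu.
apply: (@le_trans _ _ (`|y - u| * `|y - u|)); last by rewrite ler_wpM2r// ltW.
have -> : `|y - u| * `|y - u| = (y - u) ^+ 2.
  by rewrite -normrM -expr2 ger0_norm ?sqr_ge0.
rewrite ler_norml.
have := sqr_ge0 (y - u); move: (sqr_ge0 y) (sqr_ge0 u); rewrite !expr2.
by case: (ltP 0 y) => ?; case: (ltP 0 u) => ? ? ? ?; apply/andP; split; nra.
Qed.

Lemma odd_bump : exists tau tau' : R -> R,
  [/\ forall s : R, is_derive s 1 tau (tau' s), continuous tau',
      forall s, 1 <= `|s| -> tau s = 0 /\ tau' s = 0,
      (forall s, `|tau s| <= 1) /\ (forall s, `|tau' s| <= 4)
    & [/\ tau 0 = 0, forall s, 0 < s < 1 -> 0 < tau s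
         & forall s, -1 < s < 0 -> tau s < 0]].
Proof.
pose m (s : R) := Num.max 0 (1 - s ^+ 2).
pose tau s := s * m s ^+ 2; pose tau' s := m s ^+ 2 + s * (- (2 * s) * (2 * m s)).
have m01 s : 0 <= m s <= 1.
  by rewrite /m; case: (ltP 0 (1 - s ^+ 2)) => h; rewrite ?lexx ?ler01//;
    apply/andP; split; nra.
have m_gt0 s : -1 < s -> s < 1 -> 0 < m s.
  by move=> s1 s2; rewrite /m lt_max; apply/orP; right; nra.
have m0 s : 1 <= `|s| -> m s = 0.
  move=> s1; rewrite /m; apply/max_idPl; rewrite subr_le0 -real_normK ?num_real//.
  by nra.
exists tau, tau'; split.
- move=> s.
  have dm : is_derive s 1 (fun s => m s ^+ 2) (- (2 * s) * (2 * m s)).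
    have d1 : is_derive s 1 (fun s : R => 1 - s ^+ 2) (- (2 * s)).
      by apply: is_derive_eq; rewrite /GRing.scale/=; ring.
    have := @is_derive1_comp R (fun u => Num.max 0 u ^+ 2) _ s _ _
      (is_derive_sqr_pos_part (1 - s ^+ 2)) d1.
    by move=> d; apply: is_derive_eq; rewrite mulrC.
  have := @is_deriveM R R id (fun s => m s ^+ 2) s 1 _ _ (is_derive_id _ _) dm.
  by move=> d; apply: is_derive_eq; rewrite /GRing.scale/= /tau'; ring.
- have cm : continuous m.
    move=> s; apply: (@continuous_max R R (fun=> 0) (fun s => 1 - s ^+ 2)).
      exact: cst_continuous.
    by apply: cvgB; [exact: cvg_cst|exact: exprn_continuous].
  move=> s; apply: cvgD; first exact: (continuous_comp (cm s) (@exprn_continuous R 2 (m s))).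
  apply: cvgM; first exact: cvg_id.
  apply: cvgM; first by apply: cvgN; apply: cvgM; [exact: cvg_cst|exact: cvg_id].
  by apply: cvgM; [exact: cvg_cst|exact: cm].
- by move=> s /m0 ms; rewrite /tau /tau' ms; split; ring.
- split=> s; have /andP[h1 h2] := m01 s; have [s1|s1] := lerP 1 `|s|.
  + by rewrite /tau m0// expr0n mulr0 normr0.
  + rewrite /tau normrM -[leRHS]mulr1 ler_pM//; first exact: ltW.
    by rewrite ger0_norm ?sqr_ge0// expr_le1.
  + by rewrite /tau' m0//; rewrite (_ : _ + _ = 0) ?normr0//; ring.
  + move: s1; rewrite ltr_norml => /andP[s1 s2].
    have s3 : 0 <= 1 - s * s by nra.
    have s4 : 0 <= s * s by nra.
    rewrite ler_norml /tau'; apply/andP; split; nra.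
- split=> [|s /andP[s1 s2]|s /andP[s1 s2]].
  + by rewrite /tau mul0r.
  + by rewrite /tau mulr_gt0// exprn_gt0// m_gt0//; lra.
  + by rewrite /tau pmulr_llt0// exprn_gt0// m_gt0//; lra.
Qed.

(** The search continues in the extreme quarter on the other side of the midpoint from [t], all of
    it at distance at least [(b - a) / 4] from [t]. *)
Lemma finite_gap (s : seq R) (a b : R) : a < b -> exists2 y, a < y < b &
  exists2 r, 0 < r & forall t, t \in s -> r <= `|t - y|.
Proof.
elim: s a b => [|t s IH] a b ab.
  by exists ((a + b) / 2); [apply/andP; split; lra|exists 1].
have [tab|tab] := ltP t ((a + b) / 2).
  have [|y /andP[ay yb] [r r0 rP]] := IH ((a + 3 * b) / 4) b; first lra.
  exists y; first by apply/andP; split; lra.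
  exists (Num.min r ((b - a) / 4)); first by rewrite lt_min r0; lra.
  move=> u; rewrite inE ge_min => /predU1P[->|/rP->//].
  by rewrite distrC ger0_norm; [apply/orP; right; lra|lra].
have [|y /andP[ay yb] [r r0 rP]] := IH a ((3 * a + b) / 4); first lra.
exists y; first by apply/andP; split; lra.
exists (Num.min r ((b - a) / 4)); first by rewrite lt_min r0; lra.
move=> u; rewrite inE ge_min => /predU1P[->|/rP->//].
by rewrite ger0_norm; [apply/orP; right; lra|lra].
Qed.

End Bump.

Section Perturbation.
Context {R : realType}.
Variables (beta : R -> R) (v : R -> R -> R) (H T T' : R -> R) (x0 r s : R).
Hypothesis beta_le1 : forall z, `|beta z| <= 1.
Hypothesis dH : forall x : R, is_derive x 1 H (v x (H x)).
Hypothesis r_gt0 : 0 < r.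
Hypothesis r_lt_s : r < s.
Hypothesis v_strip : forall x z, `|x - x0| < s -> `|z| < r ->
  v x (H x + z) = v x (H x).
Hypothesis dT : forall x : R, is_derive x 1 T (T' x).
Hypothesis T_support : forall x, r <= `|x - x0| -> T x = 0 /\ T' x = 0.

Let H_cont : continuous H.
Proof. by move=> x; exact: is_derive_continuous (dH x). Qed.

Let T_cont : continuous T.
Proof. by move=> x; exact: is_derive_continuous (dT x). Qed.

(* The function [max 0 (r^2 - (h - H)^2)^2] has zero derivative in the strip, where
   [h - H] does, and outside the strip, hence [h] never leaves the strip. *)
Lemma strip_leaf (h : R -> R) (a : R) : (forall x : R, is_derive x 1 h (v x (h x))) ->
  `|a - x0| < s -> `|h a - H a| < r ->
  forall x, `|x - x0| < s -> h x - H x = h a - H a.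
Proof.
move=> dh aI ha.
have du (x : R) : is_derive x 1 (h - H) (v x (h x) - v x (H x)) by exact: is_deriveB.
have du0 x : `|x - x0| < s -> `|h x - H x| < r -> v x (h x) - v x (H x) = 0.
  by move=> xI /(v_strip xI); rewrite addrC subrK => ->; rewrite subrr.
have u_stays x : `|x - x0| < s -> `|h x - H x| < r.
  move=> xI; pose g (u : R) := Num.max 0 (r ^+ 2 - u ^+ 2) ^+ 2.
  have g0 u : 0 < g u -> `|u| < r.
    rewrite /g; case: (ltP 0 (r ^+ 2 - u ^+ 2)) => [+ _|_]; last by rewrite expr0n ltxx.
    rewrite subr_gt0 -(real_normK (num_real u)) ltr_pXn2r// nnegrE.
    exact: ltW.
  have dg (u : R) : is_derive u 1 g (- (2 * u) * (2 * Num.max 0 (r ^+ 2 - u ^+ 2))).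
    have d1 : is_derive u 1 (fun u : R => r ^+ 2 - u ^+ 2) (- (2 * u)).
      by apply: is_derive_eq; rewrite /GRing.scale/=; ring.
    have := @is_derive1_comp R (fun u => Num.max 0 u ^+ 2) _ u _ _
      (is_derive_sqr_pos_part (r ^+ 2 - u ^+ 2)) d1.
    by move=> d; apply: is_derive_eq; rewrite mulrC.
  have dgu t : `|t - x0| < s -> is_derive t 1 (g \o (h - H)) 0.
    move=> tI; have := @is_derive1_comp R g (h - H) t _ _ (dg _) (du t).
    move=> d; apply: is_derive_eq d _.
    have [/(du0 _ tI)->|rt] := ltP `|h t - H t| r; first by rewrite mulr0.
    rewrite (_ : Num.max 0 _ = 0) ?mulr0 ?mul0r//; apply/max_idPl.
    rewrite subr_le0 -(real_normK (num_real ((h - H) t))) !expr2.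
    by apply: ler_pM; rewrite ?(ltW r_gt0)//; exact: rt.
  have gE : g (h x - H x) = g (h a - H a) := is_derive0_cst_in dgu xI aI.
  apply: g0; rewrite gE /g exprn_gt0// lt_max subr_gt0 -(real_normK (num_real (h a - H a))).
  by apply/orP; right; rewrite !expr2; apply: ltr_pM.
move=> x xI.
suff dI (t : R) : `|t - x0| < s -> is_derive t 1 (h - H) 0.
  exact: (is_derive0_cst_in dI xI aI).
by move=> tI; have := du t; rewrite (du0 t tI (u_stays _ tI)).
Qed.

(** The coordinate [(y - H x) / r] turns the strip around the leaf [H] into [(-1, 1)], where the
    flow runs for the time [T x]. *)
Definition twist (chi : R -> R -> R) x y := H x + r * chi (T x) ((y - H x) / r).

(** The flow [chi] does not occur: twists by different flows of [beta] lead to the same equation. *)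
Definition twisted_field x y := v x y + r * T' x * beta ((y - H x) / r).

Variable chi : R -> R -> R.
Hypothesis chi_flow : complete_flow beta chi.

Let rr z : r * (z / r) = z. Proof. by rewrite mulrC divfK// gt_eqF. Qed.

Let rr' z : r * z / r = z. Proof. by rewrite mulrC mulKf// gt_eqF. Qed.

Lemma twist_id x y : T x = 0 \/ r <= `|y - H x| -> twist chi x y = y.
Proof.
have [_ _ chi0 chi1] := chi_flow.
rewrite /twist => -[->|ry]; first by rewrite chi0 rr; ring.
rewrite chi1 ?rr; first by ring.
by rewrite normrM normfV (gtr0_norm r_gt0) ler_pdivlMr// mul1r.
Qed.

Lemma twist_dist x y : `|twist chi x y - y| <= r * `|T x|.
Proof.
have [_ dchi chi0 _] := chi_flow.
have -> : twist chi x y - y = r * (chi (T x) ((y - H x) / r) - (y - H x) / r).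
  by rewrite mulrBr rr /twist; ring.
rewrite normrM gtr0_norm// ler_wpM2l ?(ltW r_gt0)//.
have [c _] := MVT_dist 0 (T x) (dchi ((y - H x) / r)).
rewrite /= chi0 => ->.
by rewrite subr0 normrM ler_piMl.
Qed.

Lemma twist_fibred : fibred_bijection (twist chi).
Proof.
have [ff _ _ _] := chi_flow; have [fm fs _] := ff.
split=> [x a b ab|x y|c x].
- by rewrite /twist ltrD2l ltr_pM2l//; apply: fm; rewrite ltr_pM2r ?invr_gt0// ltrD2r.
- have [z zE] := fs (T x) ((y - H x) / r).
  exists (H x + r * z); rewrite /twist.
  by rewrite (_ : (H x + r * z - H x) / r = z) ?zE ?rr; [ring|rewrite addrC addKr rr'].
- rewrite /twist; apply: cvgD; first exact: H_cont.
  apply: cvgM; first exact: cvg_cst.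
  apply: (@jointly_continuous_comp R chi T (fun x => (c - H x) / r) x
    (fibred_jointly_continuous ff)); first exact: T_cont.
  have cH : {for x, continuous (fun x => c - H x)}.
    by apply: cvgB; [exact: cvg_cst|exact: H_cont].
  exact: (cvgM cH (cvg_cst _)).
Qed.

Let chi_lt1 t z : `|z| < 1 -> `|chi t z| < 1.
Proof.
have [ff _ _ chi1] := chi_flow.
rewrite !ltr_norml => /andP[z1 z2].
rewrite -{1}(chi1 t (-1)) ?normrN ?normr1// -{2}(chi1 t 1) ?normr1//.
by rewrite !(fibred_mono t ff) z1.
Qed.

Let beta0 z : 1 <= `|z| -> beta z = 0.
Proof.
have [_ dchi chi0 chi1] := chi_flow; move=> z1.
have := dchi z 0; rewrite chi0 => d1.
have d2 : is_derive (0 : R) 1 (chi^~ z) 0.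
  apply: (@is_derive_near _ (cst z) _ _ _ 1) => //.
  by move=> y _; rewrite chi1.
by case: d1 => _ <-; case: d2.
Qed.

(** Inside the strip [h - H] is constant, so the chain rule yields exactly the added term, and [v]
    keeps its value because [chi] preserves [(-1, 1)]. Outside the strip, or off the support of [T],
    the twist is the identity and the added term is [0]. *)
Lemma twist_solution (h : R -> R) :
  (forall x : R, is_derive x 1 h (v x (h x))) ->
  forall x : R, is_derive x 1 (fun x => twist chi x (h x))
    (twisted_field x (twist chi x (h x))).
Proof.
move=> dh x; have [_ dchi _ _] := chi_flow.
have h_cont : continuous h by move=> y; exact: is_derive_continuous (dh y).
have [xr|xr] := ltP r `|x - x0|.
  have [Tx T'x] := T_support (ltW xr).
  rewrite twist_id; last by left.
  rewrite /twisted_field T'x mulr0 mul0r addr0.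
  apply: (@is_derive_near _ h _ _ _ (`|x - x0| - r)); rewrite ?subr_gt0// => y yx.
  rewrite twist_id//; left; apply: (T_support _).1.
  have := lerB_dist (x - x0) (x - y).
  by rewrite (_ : x - x0 - (x - y) = y - x0); [rewrite (distrC x y); lra|ring].
(* Because [r < s], a point on the edge of the support of [T] still has a full neighbourhood over
   which the strip hypothesis holds. *)
have xs : `|x - x0| < s by exact: le_lt_trans r_lt_s.
have xd : 0 < s - `|x - x0| by rewrite subr_gt0.
have near_s y : `|y - x| < s - `|x - x0| -> `|y - x0| < s.
  move=> yx; have := ler_normD (y - x) (x - x0).
  by rewrite (_ : y - x + (x - x0) = y - x0); [lra|ring].
have [hr|hr] := ltP `|h x - H x| r.
  set z := h x - H x in hr *.
  have zr : `|z / r| < 1 by rewrite normrM normfV (gtr0_norm r_gt0) ltr_pdivrMr// mul1r.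
  rewrite {2}/twist -/z /twisted_field.
  have -> : (H x + r * chi (T x) (z / r) - H x) / r = chi (T x) (z / r).
    by rewrite addrC addKr rr'.
  rewrite v_strip//; last first.
    by rewrite normrM gtr0_norm// gtr_pMr// chi_lt1.
  apply: (@is_derive_near _ (fun x => H x + r * chi (T x) (z / r)) _ _ _
    (s - `|x - x0|)) => //.
    by move=> y yx; rewrite /twist (strip_leaf dh xs hr (near_s _ yx)).
  have d1 := @is_derive1_comp R (chi^~ (z / r)) T x _ _ (dchi _ (T x)) (dT x).
  have d2 := is_deriveD (dH x) (is_deriveZ r d1).
  by apply: is_derive_eq d2 _; rewrite /GRing.scale/=; ring.
rewrite twist_id; last by right.
rewrite /twisted_field beta0 ?mulr0 ?addr0; last first.
  by rewrite normrM normfV (gtr0_norm r_gt0) ler_pdivlMr// mul1r.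
apply: (@is_derive_near _ h _ _ _ (s - `|x - x0|)) => // y yx.
rewrite twist_id//; right; rewrite leNgt; apply/negP => hy.
by have := strip_leaf dh (near_s _ yx) hy xs => hE; move: hr; rewrite hE leNgt hy.
Qed.

Lemma twist_solution_family f : solution_family v f ->
  solution_family twisted_field (fun x c => twist chi x (f x c)).
Proof.
move=> [ff df]; split; first exact: fibred_comp twist_fibred ff.
by move=> c x; exact: (twist_solution (df c)).
Qed.

End Perturbation.

Definition crosses (R : realType) (f g : R -> R -> R) (x0 c d : R) :=
  f x0 c = g x0 d /\ exists2 e, 0 < e & forall x, `|x - x0| < e ->
    (x0 < x -> g x d < f x c) /\ (x < x0 -> f x c < g x d).

Section Step.
Context {R : realType}.
Implicit Types (f g v : R -> R -> R).

Lemma twisted_field_continuous (beta : R -> R) v (H T' : R -> R) (r : R) :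
  continuous beta -> continuous H -> continuous T' -> jointly_continuous v ->
  jointly_continuous (twisted_field beta v H T' r).
Proof.
move=> cbeta cH cT' /jointly_continuousP cv; apply/jointly_continuousP => p.
apply: cvgD; first exact: cv.
apply: cvgM.
  apply: cvgM; first exact: cvg_cst.
  exact: (continuous_comp (@cvg_fst _ _ _ _ _) (cT' _)).
have c1 : {for p, continuous (fun p : R * R => (p.2 - H p.1) / r)}.
  apply: cvgM; last exact: cvg_cst.
  apply: cvgB; first exact: cvg_snd.
  exact: (continuous_comp (@cvg_fst _ _ _ _ _) (cH _)).
exact: (continuous_comp c1 (cbeta _)).
Qed.

(** From a point near which [v] is vertically constant, a small vertical move reaches a height
    [H x1 + r * z] with [beta] constant near [z]. By continuity of [H], [(w - H t) / r] stays near
    [z] for all [(t, w)] close by. *)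
Lemma twisted_field_vertically_constant (beta : R -> R) v (H T' : R -> R) (r : R) :
  0 < r -> continuous H -> densely_locally_constant beta ->
  densely_vertically_constant v ->
  densely_vertically_constant (twisted_field beta v H T' r).
Proof.
move=> r0 cH cbeta cv x y e e0.
have e20 : 0 < e / 2 by lra.
have [x1 [y1 [xx1 yy1 [r1 r10 vc]]]] := cv x y _ e20.
pose q := Num.min (e / 2) (r1 / 2).
have q0 : 0 < q by rewrite lt_min e20; lra.
have qe : q <= e / 2 by rewrite ge_min lexx.
have qr : q <= r1 / 2 by rewrite ge_min lexx orbT.
have [|z /andP[z1 z2] [d d0 dP]] := cbeta ((y1 - q - H x1) / r) ((y1 + q - H x1) / r).
  by rewrite ltr_pM2r ?invr_gt0//; lra.
have rd0 : 0 < r * d / 2 by rewrite !mulr_gt0//; lra.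
have /continuous_atP/(_ _ rd0)[c c0 cP] := cH x1.
move: z1 z2; rewrite ltr_pdivrMr// ltr_pdivlMr// => z1 z2.
pose y2 := H x1 + r * z.
exists x1, y2; split; first by clear -xx1 e0; lra.
  move: yy1; rewrite /y2 !ltr_norml => /andP[h1 h2].
  by clear -h1 h2 z1 z2 qe; apply/andP; split; lra.
exists (Num.min c (Num.min (r1 / 2) (r * d / 2))).
  by rewrite !lt_min c0 rd0; lra.
move=> t w1 w2; rewrite !lt_min => /and3P[/cP Ht t1 t2] /and3P[_ w11 w12] /and3P[_ w21 w22].
have vcase w : `|w - y2| < r1 / 2 -> `|w - y1| < r1.
  rewrite /y2 !ltr_norml => /andP[h1 h2].
  by clear -h1 h2 z1 z2 qr; apply/andP; split; lra.
have bcase w : `|w - y2| < r * d / 2 -> beta ((w - H t) / r) = beta z.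
  move=> wd; apply: dP.
  rewrite (_ : _ - z = (w - y2 - (H t - H x1)) / r); last first.
    by rewrite /y2; field; rewrite gt_eqF.
  rewrite normrM normfV (gtr0_norm r0) ltr_pdivrMr//.
  apply: le_lt_trans (ler_normB _ _) _.
  by clear -wd Ht; lra.
rewrite /twisted_field !bcase// (vc t w1 w2)//; [|exact: vcase..].
by apply: lt_le_trans t1 _; clear -r10; lra.
Qed.

(** The box is centred on a leaf [H] that both families share near [x0]; [f] is twisted by [phi] and
    [g] by [psi], which separates the two copies of [H] with opposite order on the two sides of
    [x0]. *)
Lemma perturbation_step v f g (C D : seq R) (x y e : R) :
  jointly_continuous v -> densely_vertically_constant v ->
  solution_family v f -> solution_family v g -> 0 < e ->
  exists v' f' g',
  [/\ jointly_continuous v', densely_vertically_constant v',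
      solution_family v' f', solution_family v' g'
    & [/\ forall x y, `|v' x y - v x y| <= e,
          (forall x c, `|f' x c - f x c| <= e) /\
          (forall x d, `|g' x d - g x d| <= e),
          forall x c, c \in C -> f' x c = f x c,
          forall x d, d \in D -> g' x d = g x d
        & exists x0 c0 d0, [/\ `|x0 - x| < e, `|f' x0 c0 - y| < e
            & crosses f' g' x0 c0 d0]]].
Proof.
move=> cv gv [ff df] [fg dg] e0.
have [beta [phi [psi [cbeta beta1 dbeta phi_flow [psi_flow [phi_psi psi_phi]]]]]] :=
  @twin_flows R.
have [tau [tau' [dtau ctau' tau0 [tau1 tau'1] [tau00 taup taun]]]] := @odd_bump R.
have e20 : 0 < e / 2 by lra.
have [x0 [y1 [xx0 yy1 [r1 r10 vc]]]] := gv x y _ e20.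
pose q := Num.min (e / 2) (r1 / 2).
have q0 : 0 < q by rewrite lt_min e20; lra.
have qe : q <= e / 2 by rewrite ge_min lexx.
have qr : q <= r1 / 2 by rewrite ge_min lexx orbT.
(* On the vertical line at [x0], the leaves to be kept stay at distance at least [r0] from the
   crossing height [y0]. *)
have [|y0 /andP[y01 y02] [r0 r00 gap]] := @finite_gap R
  (map (f x0) C ++ map (g x0) D) (y1 - q) (y1 + q); first lra.
have [_ fs _] := ff; have [_ gs _] := fg.
have [c0 fc0] := fs x0 y0; have [d0 gd0] := gs x0 y0.
pose H := f^~ c0.
have dH : forall x : R, is_derive x 1 H (v x (H x)) by exact: df.
have cH : continuous H by move=> t; exact: is_derive_continuous (dH t).
have r14 : 0 < r1 / 4 by lra.
have /continuous_atP/(_ _ r14)[s1 s10 s1P] := cH x0.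
pose s := Num.min s1 r1.
have s0 : 0 < s by rewrite lt_min s10.
(* A point of the strip is within [r1] of [y1]: [r1 / 4] for the variation of [H], [r1 / 2] for
   [y0 - y1], [r1 / 4] for the strip. The bound [r0] spares the leaves of [C] and [D], and [1] makes
   displacements at most [|T|]. *)
pose r := Num.min (Num.min (s / 2) (r1 / 4)) (Num.min r0 1).
have r_gt0 : 0 < r by rewrite !lt_min r00 r14 ltr01 !andbT; lra.
have [rs rr1 rr0 r_le1] : [/\ r <= s / 2, r <= r1 / 4, r <= r0 & r <= 1].
  by rewrite /r; split; rewrite !ge_min lexx ?orbT.
have r_lt_s : r < s by clear -rs s0; lra.
have v_strip t z : `|t - x0| < s -> `|z| < r -> v t (H t + z) = v t (H t).
  rewrite lt_min => /andP[/s1P Ht t1] zr; apply: vc => //.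
    move: Ht zr; rewrite /H fc0 !ltr_norml => /andP[h1 h2] /andP[h3 h4].
    by clear -h1 h2 h3 h4 y01 y02 qr rr1; apply/andP; split; lra.
  move: Ht; rewrite /H fc0 !ltr_norml => /andP[h1 h2].
  by clear -h1 h2 y01 y02 qr r10; apply/andP; split; lra.
(* The [4] cancels the bound on [tau'], so that the field changes by at most [e]. *)
pose eta := e / 4; have eta0 : 0 < eta by rewrite divr_gt0.
pose T t := eta * tau ((t - x0) / r).
pose T' t := eta / r * tau' ((t - x0) / r).
have dT (t : R) : is_derive t 1 T (T' t).
  have d1 : is_derive t 1 (fun t : R => (t - x0) / r) r^-1.
    by apply: is_derive_eq; rewrite /GRing.scale/=; ring.
  have := @is_derive1_comp R tau (fun t : R => (t - x0) / r) t _ _ (dtau _) d1.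
  move=> d2; have d3 := is_deriveZ eta d2.
  by apply: is_derive_eq d3 _; rewrite /GRing.scale/= /T'; ring.
have norm_r t : `|(t - x0) / r| = `|t - x0| / r.
  by rewrite normrM normfV (gtr0_norm r_gt0).
have T_supp t : r <= `|t - x0| -> T t = 0 /\ T' t = 0.
  move=> rt; have [|t1 t2] := tau0 ((t - x0) / r).
    by rewrite norm_r ler_pdivlMr// mul1r.
  by rewrite /T /T' t1 t2 !mulr0.
have T_le t : `|T t| <= eta by rewrite normrM (gtr0_norm eta0) ger_pMr.
have T'_le t : `|r * T' t| <= e.
  have -> : r * T' t = eta * tau' ((t - x0) / r).
    by rewrite /T'; field; rewrite gt_eqF.
  rewrite normrM (gtr0_norm eta0) -(divfK (_ : 4 != 0) e)//.
  by rewrite ler_pM2l.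
have cT' : continuous T'.
  move=> t; apply: cvgM; first exact: cvg_cst.
  have c1 : {for t, continuous (fun t : R => (t - x0) / r)}.
    apply: cvgM; last exact: cvg_cst.
    by apply: cvgB; [exact: cvg_id|exact: cvg_cst].
  exact: (continuous_comp c1 (ctau' _)).
have T_gt0 t : x0 < t -> t < x0 + r -> 0 < T t.
  move=> t1 t2; rewrite mulr_gt0// taup//.
  by rewrite divr_gt0 ?subr_gt0//= ltr_pdivrMr// mul1r ltrBlDl.
have T_lt0 t : x0 - r < t -> t < x0 -> T t < 0.
  move=> t1 t2; rewrite pmulr_rlt0// taun//.
  rewrite ltr_pdivlMr// mulN1r ltr_pdivrMr// mul0r subr_lt0 t2 andbT.
  by rewrite ltrBrDl.
have leaf h := @strip_leaf R v H x0 r s dH r_gt0 v_strip h.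
pose F chi h := fun x c : R => twist H T r chi x (h x c).
have F_close chi h t c : complete_flow beta chi -> `|F chi h t c - h t c| <= e.
  move=> chi_flow; rewrite /F (le_trans (twist_dist H T beta1 r_gt0 chi_flow _ _))//.
  apply: (@le_trans _ _ `|T t|); first by rewrite ler_piMl.
  by apply: le_trans (T_le t) _; rewrite /eta; clear -e0; lra.
(* A leaf inside the strip at some [t] of the support would keep its distance to [H] back to [x0],
   where it is at least [r]. *)
have F_fix chi h t c : complete_flow beta chi ->
    (forall x : R, is_derive x 1 (h^~ c) (v x (h x c))) -> r <= `|h x0 c - y0| ->
    F chi h t c = h t c.
  move=> chi_flow dh rh; apply: (twist_id r_gt0 chi_flow).
  have [/T_supp[Tt _]|tr] := leP r `|t - x0|; [by left|right].
  rewrite leNgt; apply/negP => hr.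
  have := leaf _ _ dh (lt_trans tr r_lt_s) hr x0.
  rewrite subrr normr0 => /(_ s0) hE.
  by move: hr; rewrite -hE ltNge /H fc0 rh.
exists (twisted_field beta v H T' r), (F phi f), (F psi g); split.
- exact: twisted_field_continuous.
- exact: twisted_field_vertically_constant.
- exact: (twist_solution_family dH r_gt0 r_lt_s v_strip dT T_supp phi_flow (conj ff df)).
- exact: (twist_solution_family dH r_gt0 r_lt_s v_strip dT T_supp psi_flow (conj fg dg)).
split.
- move=> x' y'; rewrite /twisted_field addrC addKr normrM.
  have := T'_le x'; have := beta1 ((y' - H x') / r).
  by move=> b1 t1; apply: le_trans t1; rewrite ler_piMr.
- by split=> x' c'; exact: F_close.
- move=> x' c cC; apply: (F_fix _ _ _ _ phi_flow (df c)).
  by apply: le_trans rr0 _; apply: gap; rewrite mem_cat map_f.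
- move=> x' c cC; apply: (F_fix _ _ _ _ psi_flow (dg c)).
  by apply: le_trans rr0 _; apply: gap; rewrite mem_cat [X in _ || X]map_f ?orbT.
have Tx0 : T x0 = 0 by rewrite /T subrr mul0r tau00 mulr0.
exists x0, c0, d0.
have fx0 : F phi f x0 c0 = y0 by rewrite /F (twist_id r_gt0 phi_flow)//; left.
have gx0 : F psi g x0 d0 = y0 by rewrite /F (twist_id r_gt0 psi_flow)//; left.
split; first by apply: lt_trans xx0 _; clear -e0; lra.
  move: yy1; rewrite fx0 !ltr_norml => /andP[h1 h2].
  by clear -h1 h2 y01 y02 qe; apply/andP; split; lra.
split; first by rewrite fx0 gx0.
exists r => // t tr.
have fE : F phi f t c0 = H t + r * phi (T t) 0 by rewrite /F /twist subrr mul0r.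
have gE : F psi g t d0 = H t + r * psi (T t) 0.
  (* By the strip lemma, the [g]-leaf through [(x0, y0)] coincides with the [f]-leaf [H] as long as
     [|t - x0| < s]. *)
  have gH : g t d0 - H t = 0.
    have x0s : `|x0 - x0| < s by rewrite subrr normr0.
    have := leaf _ x0 (dg d0) x0s; rewrite gd0 /H fc0 subrr normr0.
    by move=> /(_ r_gt0 t (lt_trans tr r_lt_s)) ->.
  by rewrite /F /twist gH mul0r.
move: tr; rewrite ltr_norml fE gE !ltrD2l !ltr_pM2l// => /andP[t1 t2].
split=> t3.
  by apply/phi_psi/T_gt0; rewrite // -ltrBlDl.
by apply/psi_phi/T_lt0; rewrite // -[x0 - r]/(x0 + - r) -ltrBrDl.
Qed.

End Step.

(** * Uniform limits *)

Section Limit.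
Context {R : realType}.

Lemma exp2N_small (e : R) : 0 < e ->
  exists N, forall n, (N <= n)%N -> (2 ^- n : R) < e.
Proof.
move=> e0; exists (Num.bound e^-1) => n Nn.
rewrite invf_plt ?posrE ?exprn_gt0//.
apply: (@lt_le_trans _ _ (Num.bound e^-1)%:R).
  by apply: archi_boundP; rewrite invr_ge0 ltW.
rewrite -natrX ler_nat (leq_trans Nn)// ltnW// ltn_expl//.
Qed.

Lemma le_exp2N (a b K : R) : (forall n, a <= b + K * 2 ^- n) -> a <= b.
Proof.
move=> ab; rewrite leNgt; apply/negP => ba.
have K1 : 0 < 1 + `|K| by rewrite ltr_wpDr.
have e0 : 0 < (a - b) / (1 + `|K|) by rewrite divr_gt0// subr_gt0.
have [N /(_ N (leqnn N))] := exp2N_small e0.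
rewrite ltr_pdivlMr// => h.
have := ab N; have := ler_norm K.
have : 0 < (2 ^- N : R) by rewrite invr_gt0 exprn_gt0.
nra.
Qed.

Lemma exp2NS n : (2 ^- n : R) = 2 * 2 ^- n.+1.
Proof. by rewrite exprS invfM mulrA divff ?mul1r// pnatr_eq0. Qed.

(** The intervals of centre [F n x y] and radius [2 ^- n] are nested; the supremum of their left
    ends lies in all of them, which gives the rate at once. *)
Lemma geometric_limit (F : nat -> R -> R -> R) :
  (forall n x y, `|F n.+1 x y - F n x y| <= 2 ^- n.+1) ->
  exists F' : R -> R -> R, forall n x y, `|F' x y - F n x y| <= 2 ^- n.
Proof.
move=> FS; pose lo x y := [set F n x y - 2 ^- n | n in setT].
exists (fun x y => sup (lo x y)) => n x y.
have lo_incr m : F m x y - 2 ^- m <= F m.+1 x y - 2 ^- m.+1.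
  by have := FS m x y; rewrite (exp2NS m) ler_norml => /andP[]; lra.
have hi_decr m : F m.+1 x y + 2 ^- m.+1 <= F m x y + 2 ^- m.
  by have := FS m x y; rewrite (exp2NS m) ler_norml => /andP[]; lra.
have lo_mono m k : (m <= k)%N -> F m x y - 2 ^- m <= F k x y - 2 ^- k.
  move=> mk; have := @homo_leq _ (fun m => F m x y - 2 ^- m) <=%R.
  by apply=> //; exact: le_trans.
have hi_mono m k : (m <= k)%N -> F k x y + 2 ^- k <= F m x y + 2 ^- m.
  move=> mk; have := @homo_leq _ (fun m => F m x y + 2 ^- m)
    (fun a b => b <= a).
  by apply=> // a b c ba; move/le_trans; exact.
have lo_hi m k : F m x y - 2 ^- m <= F k x y + 2 ^- k.
  have := lo_mono m (maxn m k) (leq_maxl _ _).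
  have := hi_mono k (maxn m k) (leq_maxr _ _).
  have : 0 < (2 ^- maxn m k : R) by rewrite invr_gt0 exprn_gt0.
  lra.
have lo_sup : has_sup (lo x y).
  split; first by exists (F 0 x y - 2 ^- 0), 0.
  by exists (F 0 x y + 2 ^- 0) => _ [m _ <-].
have h1 : F n x y - 2 ^- n <= sup (lo x y).
  by apply: ub_le_sup; [case: lo_sup|exists n].
have h2 : sup (lo x y) <= F n x y + 2 ^- n.
  by apply: ge_sup; [case: lo_sup|move=> _ [m _ <-]].
by rewrite ler_norml; apply/andP; split; lra.
Qed.

Lemma uniform_limit_jointly_continuous (F : nat -> R -> R -> R) F' :
  (forall n x y, `|F' x y - F n x y| <= 2 ^- n) ->
  (forall n, jointly_continuous (F n)) -> jointly_continuous F'.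
Proof.
move=> FF cF x y e e0; have e3 : 0 < e / 3 by lra.
have [N /(_ N (leqnn N)) N3] := exp2N_small e3.
have [d d0 dP] := cF N x y _ e3; exists d => // x' y' xx yy.
have := dP x' y' xx yy; have := FF N x y; have := FF N x' y'.
rewrite !ler_norml !ltr_norml => /andP[? ?] /andP[? ?] /andP[? ?].
by apply/andP; split; lra.
Qed.

Lemma uniform_limit_continuous (h : nat -> R -> R) h' :
  (forall n x, `|h' x - h n x| <= 2 ^- n) ->
  (forall n, continuous (h n)) -> continuous h'.
Proof.
move=> hh ch.
have : jointly_continuous (fun _ : R => h').
  apply: (@uniform_limit_jointly_continuous (fun n _ => h n)) => // n x y e e0.
  have /continuous_atP/(_ e e0)[d d0 dP] := ch n y.
  by exists d => // x' y' _ /dP.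
by move=> /jointly_continuous_sections[/(_ 0)].
Qed.

(** The mean value theorem for [h k] bounds the deviation by [e / 2 * |y - x|] plus an error of
    order [2 ^- k]. The neighbourhood of [x] does not depend on [k], so [k] can tend to infinity
    with [y] fixed. *)
Lemma uniform_limit_solution (v : nat -> R -> R -> R) v' (h : nat -> R -> R) h' :
  (forall n x y, `|v' x y - v n x y| <= 2 ^- n) -> jointly_continuous v' ->
  (forall n x, `|h' x - h n x| <= 2 ^- n) ->
  (forall n (x : R), is_derive x 1 (h n) (v n x (h n x))) ->
  forall x : R, is_derive x 1 h' (v' x (h' x)).
Proof.
move=> vv cv hh dh x.
have ch : continuous h'.
  apply: (uniform_limit_continuous hh) => n y; exact: is_derive_continuous (dh n y).
apply/is_deriveP => e e0; have e2 : 0 < e / 2 by lra.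
have [d d0 dP] := cv x (h' x) _ e2.
have d2 : 0 < d / 2 by lra.
have /continuous_atP/(_ _ d2)[d1 d10 d1P] := ch x.
have [N NP] := exp2N_small d2.
exists (Num.min d d1) => [|y]; first by rewrite lt_min d0.
rewrite lt_min => /andP[yd yd1].
suff H n : `|h' y - h' x - v' x (h' x) * (y - x)| <=
    e / 2 * `|y - x| + (2 + `|y - x|) * 2 ^- (maxn N n).
  have : `|h' y - h' x - v' x (h' x) * (y - x)| <= e / 2 * `|y - x|.
    apply: (@le_exp2N _ _ (2 + `|y - x|)) => n; apply: (le_trans (H n)).
    rewrite lerD2l ler_wpM2l//.
    by rewrite lef_pV2 ?posrE ?exprn_gt0// ler_weXn2l// ?leq_maxr// ler1n.
  by have := normr_ge0 (y - x); nra.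
set k := maxn N n.
have kd : 2 ^- k < d / 2 by apply: NP; exact: leq_maxl.
have [c cx cE] := MVT_dist x y (dh k).
have hc : `|h k c - h' x| < d.
  have := hh k c; have := d1P c (le_lt_trans cx yd1).
  rewrite !ler_norml !ltr_norml => /andP[? ?] /andP[? ?].
  by apply/andP; split; lra.
have vc : `|v k c (h k c) - v' x (h' x)| <= e / 2 + 2 ^- k.
  have := dP c (h k c) (le_lt_trans cx yd) hc; have := vv k c (h k c).
  rewrite !ler_norml !ltr_norml => /andP[? ?] /andP[? ?].
  by apply/andP; split; lra.
have -> : h' y - h' x - v' x (h' x) * (y - x) =
    (h' y - h k y) - (h' x - h k x) + (v k c (h k c) - v' x (h' x)) * (y - x).
  have vE : v k c (h k c) * (y - x) = h k y - h k x by rewrite cE.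
  rewrite [(v k c _ - _) * _]mulrBl vE; ring.
apply: (le_trans (ler_normD _ _)); rewrite normrM.
have := ler_normB (h' y - h k y) (h' x - h k x).
have := hh k x; have := hh k y; have := normr_ge0 (y - x); nra.
Qed.

End Limit.

Section Iteration.
Context {R : realType}.

(* [stage_C] and [stage_D] label the leaves that no later stage moves. *)
Record stage := Stage {
  stage_v : R -> R -> R;
  stage_f : R -> R -> R;
  stage_g : R -> R -> R;
  stage_C : seq R;
  stage_D : seq R;
  stage_cont : jointly_continuous stage_v;
  stage_const : densely_vertically_constant stage_v;
  stage_solf : solution_family stage_v stage_f;
  stage_solg : solution_family stage_v stage_g }.

(** Stage [n] serves one target, a rational point with a precision [1 / k.+1], and freezes one more
    rational label, [lbl n]. *)
Let tgt n : rat * rat * nat := odflt (0, 0, 0%N) (unpickle n).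
Let lbl n : R := ratr (odflt 0 (unpickle n)).

Definition refines n (S S' : stage) :=
  [/\ forall x y, `|stage_v S' x y - stage_v S x y| <= 2 ^- n.+1,
      (forall x y, `|stage_f S' x y - stage_f S x y| <= 2 ^- n.+1) /\
      (forall x y, `|stage_g S' x y - stage_g S x y| <= 2 ^- n.+1),
      (forall x c, c \in stage_C S -> stage_f S' x c = stage_f S x c) /\
      (forall x c, c \in stage_D S -> stage_g S' x c = stage_g S x c),
      [/\ {subset stage_C S <= stage_C S'}, {subset stage_D S <= stage_D S'},
          lbl n \in stage_C S' & lbl n \in stage_D S']
    & exists x0 c0 d0,
        [/\ `|x0 - ratr (tgt n).1.1| < (tgt n).2.+1%:R^-1,
            `|stage_f S' x0 c0 - ratr (tgt n).1.2| < (tgt n).2.+1%:R^-1,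
            crosses (stage_f S') (stage_g S') x0 c0 d0,
            c0 \in stage_C S' & d0 \in stage_D S']].

Lemma refines_total n S : exists S', refines n S S'.
Proof.
case: S => v f g C D cv gv sf sg.
pose e : R := Num.min (2 ^- n.+1) (tgt n).2.+1%:R^-1.
have e0 : 0 < e by rewrite lt_min !invr_gt0 exprn_gt0//=.
have e1 : e <= 2 ^- n.+1 by rewrite ge_min lexx.
have e2 : e <= (tgt n).2.+1%:R^-1 by rewrite ge_min lexx orbT.
have [v' [f' [g' [cv' gv' sf' sg' [vv [ff gg] fC gD [x0 [c0 [d0 [xx yy cr]]]]]]]]] :=
  perturbation_step C D (ratr (tgt n).1.1) (ratr (tgt n).1.2) cv gv sf sg e0.
exists (@Stage v' f' g' (c0 :: lbl n :: C) (d0 :: lbl n :: D) cv' gv' sf' sg').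
split=> /=.
- by move=> x y; exact: le_trans (vv x y) e1.
- by split=> x y; [exact: le_trans (ff x y) e1|exact: le_trans (gg x y) e1].
- by [].
- by split=> [c cC|c cC||]; rewrite !inE ?cC ?eqxx ?orbT.
- exists x0, c0, d0; split; rewrite ?inE ?eqxx//.
    exact: lt_le_trans e2.
  exact: lt_le_trans e2.
Qed.

Lemma initial_stage : inhabited stage.
Proof.
have s0 : solution_family (fun _ _ : R => 0 : R) (fun _ c => c).
  split; last by move=> c x; exact: is_derive_cst.
  by split=> [x a b|x y|c]; [|exists y|exact: cst_continuous].
split; apply: (@Stage (fun _ _ => 0) (fun _ c => c) (fun _ c => c) [::] [::]) => //.
- by move=> x y e e0; exists 1 => // x' y' _ _; rewrite subrr normr0.
- by move=> x y e e0; exists x, y; rewrite !subrr !normr0; split=> //; exists 1.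
Qed.

Lemma refining_sequence : exists S : nat -> stage,
  forall n, refines n (S n) (S n.+1).
Proof.
have [S0] := initial_stage.
pose S := fix S n := if n is m.+1 then projT1 (cid (refines_total m (S m))) else S0.
by exists S => n /=; case: cid.
Qed.

(* The rational leaves stabilize, so that the limit stays injective on each
   vertical line. *)
Lemma limit_family (F : nat -> R -> R -> R) (K : nat -> seq R) F'
    (v : nat -> R -> R -> R) v' :
  (forall n x y, `|v' x y - v n x y| <= 2 ^- n) -> jointly_continuous v' ->
  (forall n x y, `|F' x y - F n x y| <= 2 ^- n) ->
  (forall n, solution_family (v n) (F n)) ->
  (forall n x c, c \in K n -> F' x c = F n x c) ->
  (forall n, {subset K n <= K n.+1}) -> (forall n, lbl n \in K n.+1) ->
  solution_family v' F'.
Proof.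
move=> vv cv FF sF KF Kinc Klbl.
have dF c x : is_derive (x : R) 1 (F'^~ c) (v' x (F' x c)).
  apply: (@uniform_limit_solution _ v v' (fun n => (F n)^~ c) (F'^~ c) vv cv).
    by move=> n t; exact: FF.
  by move=> n t; have [_] := sF n; exact.
have Ksub n m : (n <= m)%N -> {subset K n <= K m}.
  move=> /subnKC <-; elim: (m - n)%N => [|k IH] z; first by rewrite addn0.
  by move=> /IH; rewrite addnS; exact: Kinc.
have F'_ndecr x a b : a <= b -> F' x a <= F' x b.
  move=> ab; apply: (@le_exp2N _ _ _ 2) => n.
  have [[Fm _ _] _] := sF n.
  have := le_mono (Fm x) a b; rewrite ab => Fab.
  have := FF n x a; have := FF n x b; rewrite !ler_norml.
  by move=> /andP[? ?] /andP[? ?]; lra.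
split=> //; split=> [x a b ab|x y|c x]; last exact: is_derive_continuous (dF c x).
- have [p /itvP pab] := rat_in_itvoo ab.
  have pb : ratr p < b by rewrite pab.
  have [q /itvP qpb] := rat_in_itvoo pb.
  pose N := (maxn (pickle p) (pickle q)).+1.
  have lblE (r : rat) : lbl (pickle r) = ratr r by rewrite /lbl pickleK.
  have pK : ratr p \in K N.
    by apply: (@Ksub (pickle p).+1); [rewrite ltnS leq_maxl|rewrite -lblE].
  have qK : ratr q \in K N.
    by apply: (@Ksub (pickle q).+1); [rewrite ltnS leq_maxr|rewrite -lblE].
  have [[Fm _ _] _] := sF N.
  apply: (@le_lt_trans _ _ (F' x (ratr p))); first by rewrite F'_ndecr// pab.
  apply: (@lt_le_trans _ _ (F' x (ratr q))); last by rewrite F'_ndecr// qpb.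
  by rewrite !(KF N)//; apply: Fm; rewrite qpb.
- have [[_ Fs _] _] := sF 0%N.
  (* The limit is within [2 ^- 0 = 1] of stage [0], hence the heights [y - 1] and [y + 1]. *)
  have [c1 c1E] := Fs x (y - 1); have [c2 c2E] := Fs x (y + 1).
  have cF' : continuous (F' x).
    apply: (@uniform_limit_continuous _ (fun n => F n x)) => [n z|n]; first exact: FF.
    have [fF _] := sF n.
    exact: (jointly_continuous_sections (fibred_jointly_continuous fF)).1.
  have [|t _ tE] := @intermediate_value _ (F' x) c1 c2 y cF'; last by exists t.
  have := FF 0%N x c1; have := FF 0%N x c2; rewrite c1E c2E expr0 invr1 !ler_norml.
  by move=> /andP[? ?] /andP[? ?]; apply/andP; split; lra.
Qed.

(** A crossing created at a stage lies on two leaves frozen by that stage. The limit families agree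
    with the stage along these whole leaves, so the crossing passes to the limit unchanged. *)
Lemma densely_crossing_families : exists v f g : R -> R -> R,
  [/\ jointly_continuous v, solution_family v f, solution_family v g
    & forall x y e, 0 < e -> exists x0 c0 d0,
        [/\ `|x0 - x| < e, `|f x0 c0 - y| < e & crosses f g x0 c0 d0]].
Proof.
have [S SP] := refining_sequence.
have [v vP] : exists v : R -> R -> R,
    forall n x y, `|v x y - stage_v (S n) x y| <= 2 ^- n.
  by apply: geometric_limit => n x y; have [+ _ _ _ _] := SP n; exact.
have [f fP] : exists f : R -> R -> R,
    forall n x y, `|f x y - stage_f (S n) x y| <= 2 ^- n.
  by apply: geometric_limit => n x y; have [_ [+ _] _ _ _] := SP n; exact.
have [g gP] : exists g : R -> R -> R,
    forall n x y, `|g x y - stage_g (S n) x y| <= 2 ^- n.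
  by apply: geometric_limit => n x y; have [_ [_ +] _ _ _] := SP n; exact.
have Cinc n : {subset stage_C (S n) <= stage_C (S n.+1)}.
  by have [_ _ _ [+ _ _ _] _] := SP n.
have Dinc n : {subset stage_D (S n) <= stage_D (S n.+1)}.
  by have [_ _ _ [_ + _ _] _] := SP n.
have stable (F : stage -> R -> R -> R) (K : stage -> seq R) F' :
    (forall n, {subset K (S n) <= K (S n.+1)}) ->
    (forall n x c, c \in K (S n) -> F (S n.+1) x c = F (S n) x c) ->
    (forall n x y, `|F' x y - F (S n) x y| <= 2 ^- n) ->
    forall n x c, c \in K (S n) -> F' x c = F (S n) x c.
  move=> Kinc KF FF n x c cK.
  have cst k : c \in K (S (n + k)%N) /\ F (S (n + k)%N) x c = F (S n) x c.
    elim: k => [|k [IH1 IH2]]; rewrite ?addn0// addnS; split; first exact: Kinc.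
    by rewrite KF.
  have close k : `|F' x c - F (S n) x c| <= 0 + 1 * 2 ^- k.
    rewrite add0r mul1r -(cst k).2; apply: le_trans (FF _ _ _) _.
    by rewrite lef_pV2 ?posrE ?exprn_gt0// ler_weXn2l// ?leq_addl// ler1n.
  by have /le_exp2N := close; rewrite normr_le0 subr_eq0 => /eqP.
have fC := stable stage_f stage_C f Cinc _ fP.
have {}fC n x c : c \in stage_C (S n) -> f x c = stage_f (S n) x c.
  by apply: fC => m t b; have [_ _ [+ _] _ _] := SP m; exact.
have gD := stable stage_g stage_D g Dinc _ gP.
have {}gD n x c : c \in stage_D (S n) -> g x c = stage_g (S n) x c.
  by apply: gD => m t b; have [_ _ [_ +] _ _] := SP m; exact.
have cv : jointly_continuous v.
  by apply: (uniform_limit_jointly_continuous vP) => n; exact: stage_cont.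
exists v, f, g; split=> //.
- have lblK n : lbl n \in stage_C (S n.+1) by have [_ _ _ [_ _ + _] _] := SP n.
  exact: (limit_family vP cv fP (fun n => stage_solf (S n)) fC Cinc lblK).
- have lblK n : lbl n \in stage_D (S n.+1) by have [_ _ _ [_ _ _ +] _] := SP n.
  exact: (limit_family vP cv gP (fun n => stage_solg (S n)) gD Dinc lblK).
move=> x y e e0.
have e2 : 0 < e / 2 by lra.
have [p /itvP px] : exists p : rat, ratr p \in `](x - e / 2), (x + e / 2)[.
  by apply: rat_in_itvoo; lra.
have [q /itvP qy] : exists q : rat, ratr q \in `](y - e / 2), (y + e / 2)[.
  by apply: rat_in_itvoo; lra.
pose k := Num.bound (e / 2)^-1.
have ke : k.+1%:R^-1 < e / 2.
  rewrite invf_plt ?posrE ?ltr0n//.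
  apply: (@lt_trans _ _ k%:R); last by rewrite ltr_nat.
  by apply: archi_boundP; rewrite invr_ge0 ltW.
pose n := pickle (p, q, k).
have [_ _ _ _ [x0 [c0 [d0 [xx yy [cr1 [d dpos cr2]] c0C d0D]]]]] := SP n.
move: xx yy; rewrite /tgt /n pickleK /= => /lt_trans/(_ ke) xx /lt_trans/(_ ke) yy.
exists x0, c0, d0; split.
- have p1 : x - e / 2 < ratr p by rewrite px.
  have p2 : ratr p < x + e / 2 by rewrite px.
  move: xx; rewrite !ltr_norml => /andP[h1 h2].
  by clear -h1 h2 p1 p2; apply/andP; split; lra.
- have q1 : y - e / 2 < ratr q by rewrite qy.
  have q2 : ratr q < y + e / 2 by rewrite qy.
  rewrite (fC n.+1)//.
  move: yy; rewrite !ltr_norml => /andP[h1 h2].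
  by clear -h1 h2 q1 q2; apply/andP; split; lra.
- split; first by rewrite (fC n.+1)// (gD n.+1).
  by exists d => // t /cr2; rewrite (fC n.+1)// (gD n.+1).
Qed.

End Iteration.

(** * Foliations by graphs *)

Section Foliations.
Context {R : realType}.

Definition graph_param (h : R -> R) (t : R) : plane R := (t, h t).

Definition unit_slope_field (v : R -> R -> R) (p : plane R) : plane R :=
  (Num.sqrt (1 + v p.1 p.2 ^+ 2))^-1 *: ((1, v p.1 p.2) : plane R).

Lemma pair_continuous (T : topologicalType) (f g : T -> R) t :
  {for t, continuous f} -> {for t, continuous g} ->
  {for t, continuous (fun u => (f u, g u) : plane R)}.
Proof. by move=> cf cg; exact: (cvg_pair cf cg). Qed.

Lemma graph_param_continuous (h : R -> R) : continuous h -> continuous (graph_param h).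
Proof.
by move=> ch t; apply: (@pair_continuous R id h); [exact: cvg_id|exact: ch].
Qed.

Lemma graph_param_derive (h : R -> R) (t l : R) : is_derive t 1 h l ->
  derivable (graph_param h) t 1 /\ derive1 (graph_param h) t = (1, l).
Proof.
move=> [dh hl].
have d1 : differentiable (id : R -> R^o) t by exact/derivable1_diffP/derivable_id.
have d2 : differentiable (h : R -> R^o) t by exact/derivable1_diffP.
have dp : differentiable (graph_param h) t by exact: differentiable_pair.
split; first exact/derivable1_diffP.
rewrite derive1E' // /graph_param diff_pair//=; congr (_, _).
  by rewrite -deriveE// derive_id.
by rewrite -deriveE// hl.
Qed.

Lemma graph_C1_parametrization (h h' : R -> R) : continuous h' ->
  (forall t : R, is_derive t 1 h (h' t)) ->
  C1_parametrization [set z : plane R | z.2 = h z.1] (graph_param h).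
Proof.
move=> ch' dh.
have dE t := (graph_param_derive (dh t)).2.
split.
- apply/seteqP; split=> [_ [t _ <-]//|[t y] /= ->].
  by exists t.
- by move=> t; exact: (graph_param_derive (dh t)).1.
- move=> t; rewrite (_ : derive1 (graph_param h) = fun t => (1, h' t)); last first.
    by apply/funext => u; exact: dE.
  apply: (@pair_continuous R (fun=> 1) h'); first exact: cvg_cst.
  exact: ch'.
- by move=> t; rewrite dE; apply/eqP => -[/eqP]; rewrite oner_eq0.
- by left=> s t [].
Qed.

Lemma connected_graph (h : R -> R) (I : set R) : continuous h -> connected I ->
  connected [set z : plane R | I z.1 /\ z.2 = h z.1].
Proof.
move=> ch cI.
rewrite (_ : [set _ | _] = graph_param h @` I).
  apply: connected_continuous_connected => //.
  exact/continuous_subspaceT/graph_param_continuous.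
apply/seteqP; split=> [[t y] /= [It ->]|_ [t It <-]//].
by exists t.
Qed.

Lemma fibred_map_continuous (f : R -> R -> R) : jointly_continuous f ->
  continuous (fun z : plane R => (z.1, f z.1 z.2) : plane R).
Proof.
move=> /jointly_continuousP cf z.
apply: (@pair_continuous _ fst (fun z => f z.1 z.2)); first exact: cvg_fst.
exact: cf.
Qed.

Lemma unit_slope_field_continuous v : jointly_continuous v ->
  continuous_unit_vector_field (unit_slope_field v).
Proof.
move=> /jointly_continuousP cv.
have pos x y : 0 < 1 + v x y ^+ 2 by rewrite ltr_wpDr// sqr_ge0.
split=> [p|[x y]].
  rewrite /unit_slope_field; apply: cvgZ.
    apply: cvgV; first by rewrite gt_eqF// sqrtr_gt0.
    have c1 : {for p, continuous (fun q : plane R => 1 + v q.1 q.2 ^+ 2)}.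
      apply: cvgD; first exact: cvg_cst.
      exact: (continuous_comp (cv p) (@exprn_continuous R 2 _)).
    exact: (continuous_comp c1 (@sqrt_continuous R _)).
  apply: (@pair_continuous _ (fun=> 1) (fun p => v p.1 p.2)); first exact: cvg_cst.
  exact: cv.
rewrite /euclidean_norm /unit_slope_field /GRing.scale/=.
rewrite (_ : _ + _ = 1) ?sqrtr1// /GRing.scale/=.
have h := sqr_sqrtr (ltW (pos x y)).
rewrite !exprMn exprVn h expr1n mulr1 -[X in X + _]mulr1 -mulrDr mulVf//.
by rewrite gt_eqF.
Qed.

(** With [P] inverse to [f] on each vertical line, the leaves are the level sets of [P], and the
    single global chart that sends [(x, y)] to [(x, P x y)] straightens them all. *)
Lemma solution_foliation v f : jointly_continuous v -> solution_family v f ->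
  exists F : foliation R,
    (forall x c, leaf F (x, f x c) = [set z : plane R | z.2 = f z.1 c]) /\
    tangent_to F (unit_slope_field v).
Proof.
move=> cv [ff df]; have [P [fK PK PP]] := fibred_inverse ff.
pose lf (p : plane R) : set (plane R) := [set z | P z.1 z.2 = P p.1 p.2].
have lfE p : lf p = [set z : plane R | z.2 = f z.1 (P p.1 p.2)].
  apply/seteqP; split=> z /=; first by move=> <-; rewrite PK.
  by rewrite /lf/= => ->; rewrite fK.
have cf c : continuous (f^~ c) by move=> t; exact: is_derive_continuous (df c t).
have param p : C1_parametrization (lf p) (graph_param (f^~ (P p.1 p.2))).
  rewrite lfE; apply: (@graph_C1_parametrization _ (fun t => v t (f t (P p.1 p.2)))).
    move=> t; apply: (@jointly_continuous_comp R v id (f^~ (P p.1 p.2)) t cv).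
      exact: cvg_id.
    exact: cf.
have lf_chart p : exists U h, U p /\ foliated_chart lf U h.
  exists setT, (fun z : plane R => (z.1, P z.1 z.2) : plane R); split=> //; split.
  - exact: openT.
  - split.
      split=> //.
        by move=> [x y] [x' y'] _ _ [<-] /(congr1 (f x)); rewrite !PK => <-.
      by move=> [x c] _; exists (x, f x c) => //=; rewrite fK.
    exists (fun z : plane R => (z.1, f z.1 z.2) : plane R); split.
    + by move=> [x y] _ /=; rewrite PK.
    + apply/continuous_subspaceT/fibred_map_continuous.
      exact: fibred_jointly_continuous.
    + apply/continuous_subspaceT/fibred_map_continuous.
      exact: fibred_jointly_continuous.
  - move=> q _; rewrite setIT connected_component_id//.
      by apply/seteqP; split=> z; [split|case].
    rewrite lfE (_ : [set _ | _] = [set z : plane R | setT z.1 /\ z.2 = f z.1 (P q.1 q.2)]).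
      apply: (connected_graph (cf _)); apply/connected_intervalP.
      by move=> ? ? _ _ ? _.
    by apply/seteqP; split=> z; [split|case].
have lf_eq p q : lf p q -> lf q = lf p by rewrite /lf/= => ->.
pose F := @Foliation R lf (fun=> erefl) lf_eq (fun p => ex_intro _ _ (param p)) lf_chart.
exists F; split=> [x c|p]; first by rewrite /= lfE/= fK.
exists (graph_param (f^~ (P p.1 p.2))), p.1; split=> //=.
  by rewrite /graph_param PK; case: p.
rewrite (graph_param_derive (df _ _)).2 PK /unit_slope_field.
set k := _^-1; have k0 : k != 0.
  by rewrite invr_eq0 gt_eqF// sqrtr_gt0 ltr_wpDr// sqr_ge0.
apply/seteqP; split=> _ [a _ <-].
  by exists (a * k) => //; rewrite scalerA.
by exists (a / k) => //; rewrite scalerA divfK.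
Qed.

End Foliations.

(** * Crossing graphs *)

Section Transversality.
Context {R : realType}.

Definition same_sign (e s : R) :=
  [\/ 0 < e /\ 0 < s, e < 0 /\ s < 0 | e = 0 /\ s = 0].

Lemma same_sign_sym e s : same_sign e s -> same_sign s e.
Proof. by case=> -[? ?]; [apply: Or31|apply: Or32|apply: Or33]. Qed.

(** The nearest-point projection of [y] to the segment between [0] and [e], for either sign of
    [e]. *)
Definition clamp (e y : R) := Num.max (Num.min 0 e) (Num.min (Num.max 0 e) y).

(* The piecewise linear homeomorphism of the line that maps the segment between
   [0] and [e] affinely onto the one between [0] and [s] and is a translation on
   each side of it; when [e = 0] the quotient is [0] and [clamp e y = 0]. *)
Definition stretch (e s y : R) := y - clamp e y + s / e * clamp e y.

Lemma clamp_pos e y : 0 < e ->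
  clamp e y = if y <= 0 then 0 else if y <= e then y else e.
Proof.
move=> e0; rewrite /clamp (min_idPl (ltW e0)) (max_idPr (ltW e0)).
have [y0|y0] := leP y 0.
  by rewrite (min_idPr _) ?(max_idPl _)//; apply: le_trans (ltW e0).
have [ye|ye] := leP y e.
  by rewrite (max_idPr (ltW y0)).
by rewrite (max_idPr (ltW e0)).
Qed.

Lemma clampN e y : clamp (- e) (- y) = - clamp e y.
Proof.
rewrite /clamp oppr_max !oppr_min oppr_max oppr0 max_minr; congr Num.min.
by apply/max_idPr; rewrite ge_min !le_max lexx.
Qed.

Lemma clamp0 y : clamp 0 y = 0.
Proof.
rewrite /clamp minxx maxxx; case: (leP 0 y) => y0; first by rewrite maxxx.
by rewrite (max_idPl (ltW y0)).
Qed.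

Lemma stretch0 s y : stretch 0 s y = y.
Proof. by rewrite /stretch clamp0 mulr0 subr0 addr0. Qed.

(** This symmetry reduces the facts below to positive [e] and [s]. *)
Lemma stretchN e s y : stretch (- e) (- s) (- y) = - stretch e s y.
Proof. by rewrite /stretch clampN invrN mulrNN; ring. Qed.

Lemma stretch_pos e s y : 0 < e -> 0 < s -> stretch e s y =
  if y <= 0 then y else if y <= e then s / e * y else y - e + s.
Proof.
move=> e0 s0; rewrite /stretch clamp_pos//; have [_|y0] := leP y 0; first by ring.
have [_|_] := leP y e; first by ring.
by rewrite divfK// gt_eqF.
Qed.

Lemma stretchK e s : same_sign e s -> cancel (stretch e s) (stretch s e).
Proof.
have pos u w y : 0 < u -> 0 < w -> stretch w u (stretch u w y) = y.
  move=> u0 w0; have wu : 0 < w / u by rewrite divr_gt0.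
  have uw0 : u / w * (w / u) = 1 by field; rewrite !gt_eqF.
  have wuu : w / u * u = w by rewrite divfK// gt_eqF.
  rewrite (stretch_pos y u0 w0); have [y0|y0] := leP y 0.
    by rewrite stretch_pos// y0.
  have [yu|yu] := leP y u.
    rewrite stretch_pos// leNgt mulr_gt0//= -[X in _ <= X]wuu ler_pM2l// yu.
    by rewrite mulrA uw0 mul1r.
  rewrite stretch_pos//.
  have -> : (y - u + w <= 0) = false by apply/negbTE; rewrite -ltNge; lra.
  have -> : (y - u + w <= w) = false by apply/negbTE; rewrite -ltNge; lra.
  by ring.
case=> -[e0 s0] y; first exact: pos.
  by have := pos (- e) (- s) (- y); rewrite !oppr_gt0 !stretchN => /(_ e0 s0)/oppr_inj.
by rewrite e0 s0 !stretch0.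
Qed.

Lemma stretch_mono e s : same_sign e s -> {homo stretch e s : a b / a < b}.
Proof.
have pos u w a b : 0 < u -> 0 < w -> a < b -> stretch u w a < stretch u w b.
  move=> u0 w0 ab; have wu : 0 < w / u by rewrite divr_gt0.
  have wuu : w / u * u = w by rewrite divfK// gt_eqF.
  rewrite !stretch_pos//.
  by case: (leP a 0) => ?; case: (leP b 0) => ?; case: (leP a u) => ?;
    case: (leP b u) => ? //; nra.
case=> -[e0 s0] a b ab; first exact: pos.
  by have := pos (- e) (- s) (- b) (- a); rewrite !oppr_gt0 !stretchN !ltrN2; exact.
by rewrite e0 s0 !stretch0.
Qed.

Lemma stretch_from0 e s : same_sign e s -> stretch e s 0 = 0.
Proof.
have pos u w : 0 < u -> 0 < w -> stretch u w 0 = 0.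
  by move=> u0 w0; rewrite stretch_pos// lexx.
case=> -[e0 s0]; first exact: pos.
  have := pos (- e) (- s); rewrite !oppr_gt0 -[X in stretch _ _ X]oppr0 stretchN.
  by move=> /(_ e0 s0)/eqP; rewrite oppr_eq0 => /eqP.
by rewrite e0 stretch0.
Qed.

Lemma stretch_end e s : same_sign e s -> stretch e s e = s.
Proof.
have pos u w : 0 < u -> 0 < w -> stretch u w u = w.
  by move=> u0 w0; rewrite stretch_pos// leNgt u0/= lexx divfK// gt_eqF.
case=> -[e0 s0]; first exact: pos.
  by have := pos (- e) (- s); rewrite !oppr_gt0 stretchN => /(_ e0 s0)/oppr_inj.
by rewrite e0 s0 stretch0.
Qed.

Lemma clamp_le e y : `|clamp e y| <= `|e|.
Proof.
have pos u z : 0 < u -> `|clamp u z| <= `|u|.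
  move=> u0; rewrite clamp_pos// (gtr0_norm u0).
  case: (leP z 0) => z0; first by rewrite normr0 ltW.
  case: (leP z u) => zu; first by rewrite gtr0_norm.
  by rewrite gtr0_norm.
have [e0|e0|<-] := ltgtP 0 e; first exact: pos.
  by rewrite -[e]opprK -[y]opprK clampN !normrN -(normrN e); apply: pos; rewrite oppr_gt0.
by rewrite clamp0.
Qed.

(** Where [u] vanishes, the slope [w / u] may have no limit. Still [stretch (u s) (w s) y] differs
    from [y] by at most [|u s| + |w s|], because [|clamp (u s) y| <= |u s|], and this tends to
    [0]. *)
Lemma stretch_fibred (u w : R -> R) : continuous u -> continuous w ->
  (forall t, same_sign (u t) (w t)) ->
  fibred_bijection (fun t => stretch (u t) (w t)).
Proof.
move=> cu cw uw; split=> [t|t y|y t].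
- exact: stretch_mono.
- by exists (stretch (w t) (u t) y); apply: stretchK; exact: same_sign_sym.
have [ut0|ut0] := eqVneq (u t) 0.
  have wt0 : w t = 0 by case: (uw t); rewrite ut0 ?ltxx => -[].
  apply/continuous_atP => e e0; have e2 : 0 < e / 2 by lra.
  have /continuous_atP/(_ _ e2)[d1 d10 d1P] := cu t.
  have /continuous_atP/(_ _ e2)[d2 d20 d2P] := cw t.
  exists (Num.min d1 d2) => [|s]; first by rewrite lt_min d10.
  rewrite lt_min => /andP[/d1P + /d2P]; rewrite ut0 wt0 !subr0 stretch0 => h1 h2.
  have -> : stretch (u s) (w s) y - y =
      - clamp (u s) y + w s * (clamp (u s) y / u s) by rewrite /stretch; ring.
  apply: (le_lt_trans (ler_normD _ _)); rewrite normrN normrM.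
  have h3 := clamp_le (u s) y.
  have h4 : `|clamp (u s) y / u s| <= 1.
    rewrite normrM normfV; have [->|us0] := eqVneq (u s) 0.
      by rewrite normr0 invr0 mulr0 ler01.
    by rewrite ler_pdivrMr ?normr_gt0// mul1r.
  by have := normr_ge0 (w s); nra.
have cl : {for t, continuous (fun t => clamp (u t) y)}.
  apply: (@continuous_max R R (fun t => Num.min 0 (u t))
    (fun t => Num.min (Num.max 0 (u t)) y)).
    by apply: (@continuous_min R R (fun=> 0) u); [exact: cvg_cst|exact: cu].
  apply: (@continuous_min R R (fun t => Num.max 0 (u t)) (fun=> y)).
    by apply: (@continuous_max R R (fun=> 0) u); [exact: cvg_cst|exact: cu].
  exact: cst_continuous.
apply: cvgD.
  by apply: cvgB; [exact: cvg_cst|exact: cl].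
apply: cvgM; last exact: cl.
by apply: cvgM; [exact: cw|apply: cvgV => //; exact: cu].
Qed.


Lemma symmetric_interval_bijection (d : R) : 0 < d -> exists sc sc' : R -> R,
  [/\ forall u, `|u| < d -> {for u, continuous sc},
      forall u, `|u| < d -> sc' (sc u) = u,
      continuous sc', forall t, `|sc' t| < d /\ sc (sc' t) = t
    & forall t, same_sign (sc' t) t].
Proof.
move=> d0; exists (fun u => u / (d - `|u|)), (fun t => d * (t / (1 + `|t|))).
have t1 (t : R) : 0 < 1 + `|t| by rewrite ltr_wpDr.
have norm_sc' (t : R) : `|d * (t / (1 + `|t|))| = d * (`|t| / (1 + `|t|)).
  by rewrite !normrM normfV (gtr0_norm d0) (gtr0_norm (t1 t)).
split=> [u ud|u ud|t|t|t].
- apply: cvgM; first exact: cvg_id.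
  apply: cvgV; first by rewrite gt_eqF// subr_gt0.
  by apply: cvgB; [exact: cvg_cst|exact: norm_continuous].
- have du : 0 < d - `|u| by rewrite subr_gt0.
  rewrite normrM normfV (gtr0_norm du); field.
  by rewrite gt_eqF//= (_ : _ + _ = d) ?gt_eqF//; ring.
- apply: cvgM; first exact: cvg_cst.
  apply: cvgM; first exact: cvg_id.
  apply: cvgV; first by rewrite gt_eqF.
  by apply: cvgD; [exact: cvg_cst|exact: norm_continuous].
- split; rewrite norm_sc'.
    by rewrite gtr_pMr// ltr_pdivrMr// mul1r ltrDr.
  field; rewrite !gt_eqF//= (_ : _ - _ = d) ?gt_eqF//; ring.
- have k : 0 < d / (1 + `|t|) by rewrite divr_gt0.
  rewrite (_ : d * _ = d / (1 + `|t|) * t); last by ring.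
  have [t0|t0|<-] := ltgtP 0 t.
  + by apply: Or31; rewrite mulr_gt0.
  + by apply: Or32; rewrite pmulr_rlt0.
  + by apply: Or33; rewrite mulr0.
Qed.

(** In the coordinates [t = tx x] and [y - b x], [B] is the horizontal axis and [A] is the graph of
    [E], where [E t] has the sign of [t]. Stretching each vertical line so that [E t] goes to [t]
    turns [A] into the diagonal and keeps [B]; the linear map from [(t, w)] to [(w, w - t)] then
    sends the two lines to the axes. *)
Lemma crossing_graphs_transverse (A B : set (plane R)) (a b : R -> R) (x0 d : R) :
  A = [set z : plane R | z.2 = a z.1] -> B = [set z : plane R | z.2 = b z.1] ->
  continuous a -> continuous b -> a x0 = b x0 -> 0 < d ->
  (forall x, `|x - x0| < d -> (x0 < x -> b x < a x) /\ (x < x0 -> a x < b x)) ->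
  topologically_transverse A B (x0, a x0).
Proof.
move=> AE BE ca cb ab d0 cross.
have [sc [sc' [csc scK csc' sc'K sc'_sign]]] := symmetric_interval_bijection d0.
pose xi t := x0 + sc' t; pose tx x := sc (x - x0); pose E t := a (xi t) - b (xi t).
have cxi : continuous xi by move=> t; apply: cvgD; [exact: cvg_cst|exact: csc'].
have cE : continuous E.
  move=> t; apply: cvgB.
    exact: (continuous_comp (cxi t) (ca _)).
  exact: (continuous_comp (cxi t) (cb _)).
have xiI t : `|xi t - x0| < d by rewrite /xi addrC addKr; case: (sc'K t).
have xiK t : tx (xi t) = t by rewrite /tx /xi addrC addKr; case: (sc'K t).
have txK x : `|x - x0| < d -> xi (tx x) = x.
  by move=> xd; rewrite /xi /tx scK// addrC subrK.
have E_sign t : same_sign (E t) t.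
  have [c1 c2] := cross _ (xiI t); rewrite /E.
  case: (sc'_sign t) => -[h1 h2]; [apply: Or31|apply: Or32|apply: Or33]; split=> //.
  - by rewrite subr_gt0 c1// /xi; lra.
  - by rewrite subr_lt0 c2// /xi; lra.
  - by rewrite /xi h1 addr0 ab subrr.
have sE t := same_sign_sym (E_sign t).
have cid : continuous (id : R -> R) by move=> t; exact: cvg_id.
have /fibred_jointly_continuous cN := stretch_fibred cE cid E_sign.
have /fibred_jointly_continuous cM := stretch_fibred cid cE sE.
pose U : set (plane R) := [set z | `|z.1 - x0| < d].
pose w (z : plane R) := stretch (E (tx z.1)) (tx z.1) (z.2 - b z.1).
pose h (z : plane R) : plane R := (w z, w z - tx z.1).
pose g (z : plane R) : plane R :=
  (xi (z.1 - z.2), stretch (z.1 - z.2) (E (z.1 - z.2)) z.1 + b (xi (z.1 - z.2))).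
have oU : open U.
  have -> : U = (fst : plane R -> R) @^-1` ball x0 d.
    by apply/seteqP; split=> z; rewrite /U /ball/= distrC.
  apply: open_comp; last exact: ball_open.
  by move=> z _; exact: cvg_fst.
have hg z : h (g z) = z.
  case: z => z1 z2; rewrite /h /w /g/= xiK addrK stretchK; last exact: sE.
  by congr (_, _); ring.
have gU z : U (g z) by exact: xiI.
have gh z : U z -> g (h z) = z.
  case: z => x y /= xd; rewrite /g /h/=.
  have -> : w (x, y) - (w (x, y) - tx x) = tx x by ring.
  by rewrite txK// /w/= stretchK// subrK.
have hU : homeomorphism_between U [set: plane R] h.
  split.
    split=> // [z z' + + hE|z _]; last by exists (g z).
    by rewrite !inE => zU z'U; rewrite -(gh z zU) hE gh.
  exists g; split; first by move=> z; rewrite inE => /gh.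
    rewrite continuous_open_subspace// => z; rewrite inE => zU.
    have ctx : {for z, continuous (fun z : plane R => tx z.1)}.
      have c1 : {for z, continuous (fun z : plane R => z.1 - x0)}.
        by apply: cvgB; [exact: cvg_fst|exact: cvg_cst].
      exact: (continuous_comp c1 (csc _ zU)).
    have cw : {for z, continuous w}.
      have c1 : {for z, continuous (fun z : plane R => z.2 - b z.1)}.
        apply: cvgB; first exact: cvg_snd.
        exact: (continuous_comp (@cvg_fst _ _ _ _ _) (cb _)).
      move/jointly_continuousP : cN => cN.
      exact: (continuous_comp (pair_continuous ctx c1) (cN _)).
    by apply: pair_continuous => //; apply: cvgB.
  apply: continuous_subspaceT => z.
  have c1 : {for z, continuous (fun z : plane R => z.1 - z.2)}.
    by apply: cvgB; [exact: cvg_fst|exact: cvg_snd].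
  have c2 : {for z, continuous (fun z : plane R => xi (z.1 - z.2))}.
    exact: (continuous_comp c1 (cxi _)).
  apply: (@pair_continuous _ _ (fun z => xi (z.1 - z.2)) (fun z : plane R =>
    stretch (z.1 - z.2) (E (z.1 - z.2)) z.1 + b (xi (z.1 - z.2)))) => //.
  apply: cvgD.
    move/jointly_continuousP : cM => cM.
    have c3 : {for z, continuous (fst : plane R -> R)} by exact: cvg_fst.
    exact: (continuous_comp (pair_continuous c1 c3) (cM _)).
  exact: (continuous_comp c2 (cb _)).
have connI : connected [set x | `|x - x0| < d].
  apply/connected_intervalP => x y /=; rewrite !ltr_norml.
  move=> /andP[? ?] /andP[? ?] z /andP[? ?].
  by rewrite ltr_norml; apply/andP; split; lra.
have x0I : `|x0 - x0| < d by rewrite subrr normr0.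
have component (C : set (plane R)) (c : R -> R) : C = [set z : plane R | z.2 = c z.1] ->
    continuous c -> c x0 = a x0 ->
    connected_component (C `&` U) (x0, a x0) = [set z | U z /\ z.2 = c z.1].
  move=> CE cc c0.
  have -> : C `&` U = [set z | U z /\ z.2 = c z.1].
    by rewrite CE; apply/seteqP; split=> z [].
  by apply: connected_component_id; [split|exact: (connected_graph cc connI)].
have tx0 : tx x0 = 0.
  have := sc'_sign (tx x0); rewrite /tx subrr scK ?normr0//.
  by case=> -[]; rewrite ?ltxx.
have wA x : `|x - x0| < d -> w (x, a x) = tx x.
  move=> xd; rewrite /w/=; have -> : a x - b x = E (tx x) by rewrite /E txK.
  exact: stretch_end.
have wB x : w (x, b x) = 0 by rewrite /w/= subrr stretch_from0.
exists U, h; split=> //.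
- by rewrite /h wA// tx0 subrr.
- rewrite (component A a)//; apply/seteqP; split=> [_ [[x y] /= [xd ->] <-]|[z1 z2] /= ->].
    by rewrite /h/= wA// subrr.
  exists (xi z1, a (xi z1)); first by split=> //=; exact: xiI.
  by rewrite /h wA ?xiK ?subrr.
- rewrite (component B b)//; apply/seteqP; split=> [_ [[x y] /= [xd ->] <-]|[z1 z2] /= ->].
    by rewrite /h/= wB.
  exists (xi (- z2), b (xi (- z2))); first by split=> //=; exact: xiI.
  by rewrite /h wB /= xiK sub0r opprK.
Qed.

End Transversality.

Theorem theorem1p2 (R : realType) :
  exists (X : plane R -> plane R) (F G : foliation R) (E : set (plane R)),
    [/\ continuous_unit_vector_field X,
        tangent_to F X,
        tangent_to G X,
        dense E
      & forall x, E x -> topologically_transverse (leaf F x) (leaf G x) x].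
Proof.
have [v [f [g [cv sf sg fg_cross]]]] := @densely_crossing_families R.
have [F [F_leaf F_tangent]] := solution_foliation cv sf.
have [G [G_leaf G_tangent]] := solution_foliation cv sg.
exists (unit_slope_field v), F, G,
  [set p : plane R | exists c d, p.2 = f p.1 c /\ crosses f g p.1 c d].
split=> //; first exact: unit_slope_field_continuous.
- move=> O [[x y] Oxy]; rewrite openE => /(_ _ Oxy)[[A B] /= [Ax By] AB].
  have [d1 /= d10 d1A] := (@nbhs_ballP R R x A).1 Ax.
  have [d2 /= d20 d2B] := (@nbhs_ballP R R y B).1 By.
  have d0 : 0 < Num.min d1 d2 by rewrite lt_min d10.
  have [x0 [c0 [d [xx yy cr]]]] := fg_cross x y _ d0.
  exists (x0, f x0 c0); split; last by exists c0, d.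
  apply: AB; split=> /=.
    by apply: d1A; rewrite /ball/= distrC; move: xx; rewrite lt_min => /andP[].
  by apply: d2B; rewrite /ball/= distrC; move: yy; rewrite lt_min => /andP[].
- move=> [x0 y0] [c [d /= [-> [fgE [e e0 cr]]]]].
  apply: (crossing_graphs_transverse (F_leaf x0 c) _ _ _ fgE e0 cr).
  + by rewrite fgE G_leaf.
  + by move=> t; have [_ df] := sf; exact: is_derive_continuous (df c t).
  + by move=> t; have [_ dg] := sg; exact: is_derive_continuous (dg d t).
Qed.
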